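(* Let $V$ be an absolute matrix order unit space and consider $\mathcal{PU}_\infty(V)\times\mathcal{PU}_\infty(V)$. For $u_1,u_2,v_1,v_2\in\mathcal{PU}_\infty(V)$ define $(u_1,v_1)\equiv_K(u_2,v_2)$ if and only if $u_1\oplus v_2\approx_K u_2\oplus v_1$. Then $\equiv_K$ is an equivalence relation on $\mathcal{PU}_\infty(V)\times\mathcal{PU}_\infty(V)$. Let $K(V)=\{[(u,v)]:u,v\in\mathcal{PU}_\infty(V)\}$, where $[(u,v)]$ is the equivalence class of $(u,v)$ with respect to $\equiv_K$, and for all $u_1,u_2,v_1,v_2\in\mathcal{PU}_\infty(V)$ write $[(u_1,v_1)]+[(u_2,v_2)]=[(u_1\oplus u_2,v_1\oplus v_2)]$. Then $(K(V),+)$ is an abelian group (in particular $+$ is well defined).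
   Context: Matrices. For a complex $*$-vector space $V$ (complex vector space with a conjugate-linear involution $*$), $M_{m,n}(V)$ denotes the $m\times n$ matrices over $V$, $M_n(V)=M_{n,n}(V)$, $M_{m,n}=M_{m,n}(\mathbb{C})$, $M_n=M_{n,n}$; products $\alpha v$, $v\beta$ with scalar matrices are the usual ones, $[v_{i,j}]^*=[v_{j,i}^*]$, $M_n(V)_{sa}=\{v\in M_n(V):v=v^*\}$, $v\oplus w=\begin{bmatrix}v&0\\0&w\end{bmatrix}$, and $0_n$ is the zero of $M_n(V)$. A matrix ordered space is a $*$-vector space $V$ with sets $M_n(V)^+\subset M_n(V)_{sa}$ ($n\in\mathbb{N}$) such that each $(M_n(V)_{sa},M_n(V)^+)$ is a real ordered vector space ($M_n(V)^+$ is a cone: closed under sums and nonnegative scalar multiples; $u\le v$ means $v-u\in M_n(V)^+$) and $\alpha^*v\alpha\in M_m(V)^+$ for all $v\in M_n(V)^+$, $\alpha\in M_{n,m}$. Write $V^+=M_1(V)^+$. An absolutely ordered space is a real ordered vector space $(X,X^+)$ with a map $|\cdot|:X\to X^+$ such that: (1) $|x|=x$ for $x\in X^+$; (2) $|x|\pm x\in X^+$ for $x\in X$; (3) $|kx|=|k||x|$ for $k\in\mathbb{R}$; (4) if $|x-y|=x+y$ and $0\le z\le y$, then $|x-z|=x+z$; (5) if $|x-y|=x+y$ and $|x-z|=x+z$, then $\big|x-|y\pm z|\big|=x+|y\pm z|$. An absolutely matrix ordered space is a matrix ordered space with maps $|\cdot|_{m,n}:M_{m,n}(V)\to M_n(V)^+$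 (write $|\cdot|_n=|\cdot|_{n,n}$) such that: each $(M_n(V)_{sa},M_n(V)^+,|\cdot|_n)$ is an absolutely ordered space; $|\alpha v\beta|_{r,s}\le\|\alpha\|\,\big||v|_{m,n}\beta\big|_{n,s}$ for $v\in M_{m,n}(V)$, $\alpha\in M_{r,m}$, $\beta\in M_{n,s}$; and $|v\oplus w|_{m+r,n+s}=|v|_{m,n}\oplus|w|_{r,s}$ for $v\in M_{m,n}(V)$, $w\in M_{r,s}(V)$. For $u,v\in M_n(V)^+$, $u\perp v$ means $|u-v|_n=u+v$. A matrix order unit space $(V,e)$ is a matrix ordered space with an order unit $e\in V^+$ for $V_{sa}$ (every $v\in V_{sa}$ satisfies $ke\pm v\in V^+$ for some $k>0$), with $V^+$ proper ($V^+\cap(-V^+)=\{0\}$) and every $M_n(V)^+$ Archimedean (if $v\in M_n(V)_{sa}$ and $ku+v\in M_n(V)^+$ for a fixed $u\in M_n(V)^+$ and all $k>0$, then $v\in M_n(V)^+$). Put $e^n=e\oplus\cdots\oplus e\in M_n(V)$. It carries the norms $\|v\|_n=\inf\{k>0:\begin{bmatrix}ke^n&v\\ v^*&ke^n\end{bmatrix}\in M_{2n}(V)^+\}$ on $M_n(V)$; continuity is with respect to these norms. For $u,v\in M_n(V)^+$, $u\perp_\infty v$ means $\|u+kv\|_n=\max\{\|u\|_n,\|kv\|_n\}$ for all $k\in\mathbb{R}$, and $u\perp_\infty^a v$ means $u_1\perp_\infty v_1$ whenever $0\le u_1\le u$ and $0\le v_1\le v$. An absolute matrix order unit space is a matrix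 order unit space $(V,e)$ that is also an absolutely matrix ordered space and for which $\perp=\perp_\infty^a$ on $M_n(V)^+$ for every $n$. Partial unitaries. $p\in M_n(V)$ is an order projection if $p^*=p$ and $|2p-e^n|_n=e^n$. $u\in M_n(V)$ is a partial unitary if $|u|_n=|u^*|_n$ and this element is an order projection; $\mathcal{PU}_n(V)$ is the set of partial unitaries in $M_n(V)$ and $\mathcal{PU}_\infty(V)=\bigcup_{n=1}^\infty\mathcal{PU}_n(V)$ (each element is a matrix of a definite size; $\oplus$ is a binary operation on it). For $u,v\in\mathcal{PU}_n(V)$, $u\sim_h v$ means there is a continuous $f:[0,1]\to\mathcal{PU}_n(V)$ with $f(0)=u$, $f(1)=v$. For $u\in\mathcal{PU}_m(V)$, $v\in\mathcal{PU}_n(V)$, $u\sim_K v$ means there is $k>\max\{m,n\}$ with $u\oplus 0_{k-m}\sim_h v\oplus 0_{k-n}$ in $\mathcal{PU}_k(V)$. For $u,v\in\mathcal{PU}_\infty(V)$, $u\approx_K v$ means there is $w\in\mathcal{PU}_\infty(V)$ with $u\oplus w\sim_K v\oplus w$. *)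

(* Defs.v *)
From HB Require Import structures.
From mathcomp Require Import all_boot all_order all_algebra.
From mathcomp Require Import complex.
From mathcomp Require Import all_classical all_reals.
From Stdlib Require Import RelationClasses.
Set Implicit Arguments.
Unset Strict Implicit.
Unset Printing Implicit Defensive.
Import Order.TTheory GRing.Theory Num.Theory.
Local Open Scope classical_set_scope.
Local Open Scope ring_scope.
Local Open Scope complex_scope.

(* The base field is the field R[i] of complex numbers over R : realType.
   MathComp matrices may have 0 rows or columns; since the matrix sizes in
   this theory are positive, all axioms and definitions below that concern
   M_{m,n}(V) carry hypotheses 0 < m, 0 < n, and the structure maps have
   arbitrary values on empty matrices. *)

(* Operator norm of a scalar matrix C^n -> C^m for the Euclidean norms. *)
Definition euclid (R : realType) n (x : 'cV[R[i]]_n) : R :=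
  Num.sqrt (\sum_i (complex.Re (x i 0) ^+ 2 + complex.Im (x i 0) ^+ 2)).

Definition opnorm (R : realType) m n (a : 'M[R[i]]_(m, n)) : R :=
  sup [set euclid (a *m x) | x in [set x : 'cV[R[i]]_n | euclid x <= 1]].

Definition adjmx (R : realType) m n (a : 'M[R[i]]_(m, n)) : 'M[R[i]]_(n, m) :=
  map_mx Num.conj a^T.

(* MathComp has no module structure on 'M[V]_(m, n) for V a general module. *)
Definition scalemxV (R : realType) (V : lmodType R[i]) m n
    (c : R[i]) (v : 'M[V]_(m, n)) : 'M[V]_(m, n) :=
  map_mx ( *:%R c) v.

Definition lmulmx (R : realType) (V : lmodType R[i]) m n p
    (a : 'M[R[i]]_(m, n)) (v : 'M[V]_(n, p)) : 'M[V]_(m, p) :=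
  \matrix_(i, j) \sum_k a i k *: v k j.

Definition rmulmx (R : realType) (V : lmodType R[i]) m n p
    (v : 'M[V]_(m, n)) (b : 'M[R[i]]_(n, p)) : 'M[V]_(m, p) :=
  \matrix_(i, j) \sum_k b k j *: v i k.

Definition dsum (V : zmodType) m n r s (v : 'M[V]_(m, n)) (w : 'M[V]_(r, s)) :
    'M[V]_(m + r, n + s) :=
  block_mx v 0 0 w.

HB.mixin Record isStarVectorSpace (R : realType) V of GRing.Lmodule R[i] V := {
  star : V -> V;
  starD : forall x y, star (x + y) = star x + star y;
  starZ : forall (c : R[i]) x, star (c *: x) = Num.conj c *: star x;
  starK : forall x, star (star x) = x
}.

#[short(type="starVectType")]
HB.structure Definition StarVectorSpace (R : realType) :=
  {V of GRing.Lmodule R[i] V & isStarVectorSpace R V}.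

Definition starmx (R : realType) (V : starVectType R) m n (v : 'M[V]_(m, n)) :
    'M[V]_(n, m) :=
  map_mx star v^T.

Definition selfadj (R : realType) (V : starVectType R) n : set 'M[V]_n :=
  [set v | starmx v = v].

HB.mixin Record isMatrixOrdered (R : realType) V of StarVectorSpace R V := {
  pos : forall n, set 'M[V]_n;
  pos_sa : forall n, (0 < n)%N -> pos n `<=` selfadj (n := n);
  pos0 : forall n, (0 < n)%N -> pos n 0;
  posD : forall n (u v : 'M[V]_n), (0 < n)%N ->
    pos n u -> pos n v -> pos n (u + v);
  posZ : forall n (k : R) (v : 'M[V]_n), (0 < n)%N ->
    0 <= k -> pos n v -> pos n (scalemxV k%:C v);
  pos_compress : forall m n (a : 'M[R[i]]_(n, m)) (v : 'M[V]_n),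
    (0 < m)%N -> (0 < n)%N ->
    pos n v -> pos m (rmulmx (lmulmx (adjmx a) v) a)
}.

#[short(type="matrixOrderedType")]
HB.structure Definition MatrixOrdered (R : realType) :=
  {V of StarVectorSpace R V & isMatrixOrdered R V}.

Arguments pos {R s} n _.

Definition lemx (R : realType) (V : matrixOrderedType R) n (u v : 'M[V]_n) :=
  pos n (v - u).

(* The absolutely ordered space axioms for (M_n(V)_sa, M_n(V)^+, ab). *)
Record absolutely_ordered (R : realType) (V : matrixOrderedType R) n
    (ab : 'M[V]_n -> 'M[V]_n) : Prop := AbsolutelyOrdered {
  ao_pos : forall x, selfadj x -> pos n (ab x);
  ao_id : forall x, pos n x -> ab x = x;
  ao_ge : forall x, selfadj x -> pos n (ab x + x) /\ pos n (ab x - x);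
  ao_scale : forall (k : R) x, selfadj x ->
    ab (scalemxV k%:C x) = scalemxV `|k|%:C (ab x);
  ao_sub : forall x y z, selfadj x -> selfadj y -> selfadj z ->
    ab (x - y) = x + y -> pos n z -> lemx z y -> ab (x - z) = x + z;
  ao_addsub : forall x y z, selfadj x -> selfadj y -> selfadj z ->
    ab (x - y) = x + y -> ab (x - z) = x + z ->
    ab (x - ab (y + z)) = x + ab (y + z) /\
    ab (x - ab (y - z)) = x + ab (y - z)
}.

HB.mixin Record isAbsMatrixOrdered (R : realType) V of MatrixOrdered R V := {
  absmx : forall m n, 'M[V]_(m, n) -> 'M[V]_n;
  absmx_pos : forall m n (v : 'M[V]_(m, n)), (0 < m)%N -> (0 < n)%N ->
    pos n (absmx m n v);
  absmx_absolutely_ordered : forall n, (0 < n)%N ->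
    absolutely_ordered (absmx n n);
  absmxM : forall m n r q
      (a : 'M[R[i]]_(r, m)) (v : 'M[V]_(m, n)) (b : 'M[R[i]]_(n, q)),
    (0 < m)%N -> (0 < n)%N -> (0 < r)%N -> (0 < q)%N ->
    lemx (absmx r q (rmulmx (lmulmx a v) b))
         (scalemxV (opnorm a)%:C (absmx n q (rmulmx (absmx m n v) b)));
  absmx_dsum : forall m n r q (v : 'M[V]_(m, n)) (w : 'M[V]_(r, q)),
    (0 < m)%N -> (0 < n)%N -> (0 < r)%N -> (0 < q)%N ->
    absmx (m + r)%N (n + q)%N (dsum v w) = dsum (absmx m n v) (absmx r q w)
}.

#[short(type="absMatrixOrderedType")]
HB.structure Definition AbsMatrixOrdered (R : realType) :=
  {V of MatrixOrdered R V & isAbsMatrixOrdered R V}.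

Arguments absmx {R s} {m n} _.

(* V is identified with M_1(V). *)
Definition posV (R : realType) (V : matrixOrderedType R) : set V :=
  [set v | pos 1 (v%:M : 'M[V]_1)].

HB.mixin Record isMatrixOrderUnit (R : realType) V of MatrixOrdered R V := {
  ounit : V;
  ounit_pos : posV ounit;
  ounitP : forall v : V, star v = v ->
    exists k : R, [/\ 0 < k, posV (k%:C *: ounit + v) &
                      posV (k%:C *: ounit - v)];
  posV_proper : forall v : V, posV v -> posV (- v) -> v = 0;
  pos_archimedean : forall n (u v : 'M[V]_n), (0 < n)%N ->
    selfadj v -> pos n u ->
    (forall k : R, 0 < k -> pos n (scalemxV k%:C u + v)) -> pos n v
}.

#[short(type="matrixOrderUnitType")]
HB.structure Definition MatrixOrderUnit (R : realType) :=
  {V of MatrixOrdered R V & isMatrixOrderUnit R V}.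

Definition ounitmx (R : realType) (V : matrixOrderUnitType R) n : 'M[V]_n :=
  (ounit : V)%:M.
Arguments ounitmx {R V} n.

Definition normmx (R : realType) (V : matrixOrderUnitType R) n (v : 'M[V]_n) :
    R :=
  inf [set k : R | 0 < k /\
    pos (n + n) (block_mx (scalemxV k%:C (ounitmx n)) v
                          (starmx v) (scalemxV k%:C (ounitmx n)))].

Definition perp (R : realType) (V : absMatrixOrderedType R) n
    (u v : 'M[V]_n) : Prop :=
  absmx (u - v) = u + v.

Definition perp_oo (R : realType) (V : matrixOrderUnitType R) n
    (u v : 'M[V]_n) : Prop :=
  forall k : R,
    normmx (u + scalemxV k%:C v) =
    Num.max (normmx u) (normmx (scalemxV k%:C v)).

Definition perp_oo_a (R : realType) (V : matrixOrderUnitType R) n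
    (u v : 'M[V]_n) : Prop :=
  forall u1 v1 : 'M[V]_n, pos n u1 -> lemx u1 u -> pos n v1 -> lemx v1 v ->
    perp_oo u1 v1.

#[short(type="absMatrixOrderedUnitType")]
HB.structure Definition AbsMatrixOrderedUnit (R : realType) :=
  {V of AbsMatrixOrdered R V & MatrixOrderUnit R V}.

HB.mixin Record perp_is_perp_oo_a (R : realType) V
    of AbsMatrixOrderedUnit R V := {
  perpE : forall n (u v : 'M[V]_n), (0 < n)%N -> pos n u -> pos n v ->
    perp u v <-> perp_oo_a u v
}.

#[short(type="absMatrixOrderUnitType")]
HB.structure Definition AbsMatrixOrderUnit (R : realType) :=
  {V of AbsMatrixOrderedUnit R V & perp_is_perp_oo_a R V}.

Definition order_projection (R : realType) (V : absMatrixOrderUnitType R) n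
    (p : 'M[V]_n) : Prop :=
  starmx p = p /\ absmx (p *+ 2 - ounitmx n) = ounitmx n.

Definition partial_unitary (R : realType) (V : absMatrixOrderUnitType R) n
    (u : 'M[V]_n) : Prop :=
  absmx u = absmx (starmx u) /\ order_projection (absmx u).

Definition homotopic (R : realType) (V : absMatrixOrderUnitType R) n
    (u v : 'M[V]_n) : Prop :=
  exists f : R -> 'M[V]_n,
    [/\ forall t, 0 <= t <= 1 -> partial_unitary (f t),
        forall t, 0 <= t <= 1 -> forall eps : R, 0 < eps ->
          exists2 delta : R, 0 < delta &
            forall s, 0 <= s <= 1 -> `|s - t| < delta ->
              normmx (f s - f t) < eps,
        f 0 = u & f 1 = v].

Record PU (R : realType) (V : absMatrixOrderUnitType R) : Type := MkPU {
  pu_size : nat;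
  pu_size_gt0 : (0 < pu_size)%N;
  pu_mx : 'M[V]_pu_size;
  pu_mxP : partial_unitary pu_mx
}.

Section DirectSum.
Variables (R : realType) (V : absMatrixOrderUnitType R).

Lemma starmx_dsum m n r s (v : 'M[V]_(m, n)) (w : 'M[V]_(r, s)) :
  starmx (dsum v w) = dsum (starmx v) (starmx w).
Proof.
have star0 : star (0 : V) = 0 by apply: (@addrI V (star 0)); rewrite -starD !addr0.
rewrite /starmx /dsum tr_block_mx map_block_mx !trmx0.
by congr block_mx; apply/matrixP => i j; rewrite !mxE.
Qed.

Lemma order_projection_dsum m n (p : 'M[V]_m) (q : 'M[V]_n) :
  (0 < m)%N -> (0 < n)%N -> order_projection p -> order_projection q ->
  order_projection (dsum p q).
Proof.
move=> m0 n0 [ps pa] [qs qa]; split; first by rewrite starmx_dsum ps qs.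
have -> : ounitmx (m + n) = dsum (ounitmx m) (ounitmx n) :> 'M[V]_(m + n).
  by rewrite /ounitmx /dsum scalar_mx_block.
rewrite -[X in _ = dsum X _]pa -[X in _ = dsum _ X]qa -absmx_dsum//.
by rewrite /dsum mulr2n add_block_mx opp_block_mx add_block_mx !oppr0 !addr0.
Qed.

Lemma partial_unitary_dsum m n (u : 'M[V]_m) (v : 'M[V]_n) :
  (0 < m)%N -> (0 < n)%N -> partial_unitary u -> partial_unitary v ->
  partial_unitary (dsum u v).
Proof.
move=> m0 n0 [uE uP] [vE vP]; split.
  by rewrite starmx_dsum !absmx_dsum// uE vE.
by rewrite absmx_dsum//; exact: order_projection_dsum.
Qed.

End DirectSum.

Lemma pu_sum_gt0 m n : (0 < m)%N -> (0 < n)%N -> (0 < m + n)%N.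
Proof. by move=> m0 _; rewrite addn_gt0 m0. Qed.

Definition pu_sum (R : realType) (V : absMatrixOrderUnitType R)
    (u v : PU V) : PU V :=
  MkPU (pu_sum_gt0 (pu_size_gt0 u) (pu_size_gt0 v))
       (partial_unitary_dsum (pu_size_gt0 u) (pu_size_gt0 v)
                             (pu_mxP u) (pu_mxP v)).

(* u (+) 0_(k - m), transported from size m + (k - m) to size k *)
Definition pad (V : zmodType) m k (ltmk : (m < k)%N) (u : 'M[V]_m) : 'M[V]_k :=
  castmx (subnKC (ltnW ltmk), subnKC (ltnW ltmk))
         (dsum u (0 : 'M[V]_(k - m))).

Definition simK (R : realType) (V : absMatrixOrderUnitType R)
    (u v : PU V) : Prop :=
  exists (k : nat) (ltu : (pu_size u < k)%N) (ltv : (pu_size v < k)%N),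
    homotopic (pad ltu (pu_mx u)) (pad ltv (pu_mx v)).

Definition approxK (R : realType) (V : absMatrixOrderUnitType R)
    (u v : PU V) : Prop :=
  exists w : PU V, simK (pu_sum u w) (pu_sum v w).

Definition equivK (R : realType) (V : absMatrixOrderUnitType R)
    (p q : PU V * PU V) : Prop :=
  approxK (pu_sum p.1 q.2) (pu_sum q.1 p.2).

Definition eclass (R : realType) (V : absMatrixOrderUnitType R)
    (p : PU V * PU V) : set (PU V * PU V) :=
  [set q | equivK p q].

Definition K (R : realType) (V : absMatrixOrderUnitType R) : Type :=
  {c : set (PU V * PU V) | range (@eclass R V) c}.

Definition Kclass (R : realType) (V : absMatrixOrderUnitType R)
    (u v : PU V) : K V :=
  exist _ (eclass (u, v)) (imageT (@eclass R V) (u, v)).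

Definition abelian_group (G : Type) (add : G -> G -> G) : Prop :=
  [/\ associative add, commutative add &
      exists zero : G, left_id zero add /\
        forall x, exists y, add y x = zero].

(* Main.v *)
(* Conjugation by a scalar unitary U preserves partial unitaries: the
   inequality for |a v b|, applied to U and to its inverse, gives
   |U^* v U| = U^* |v| U. For a self-adjoint scalar involution P the unitaries
   c + i s P with c^2 + s^2 = 1 therefore join u to P u P by a path of partial
   unitaries. Exchanging the coordinates used by u with unused ones is such an
   involution, so after adding zeros the position of u inside a larger matrix
   does not matter up to homotopy. Hence partial unitaries up to ~_K form a
   commutative semigroup, and K(V) is its Grothendieck group. *)
Require Import Defs.
From HB Require Import structures.
From mathcomp Require Import all_boot all_order all_algebra.
From mathcomp Require Import complex.
From mathcomp Require Import all_classical all_reals.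
From Stdlib Require Import RelationClasses.
From mathcomp Require Import ring lra.
Set Implicit Arguments.
Unset Strict Implicit.
Unset Printing Implicit Defensive.
Import Order.TTheory GRing.Theory Num.Theory.
Local Open Scope classical_set_scope.
Local Open Scope ring_scope.
Local Open Scope complex_scope.

(** The axioms for the absolute value give only inequalities. Turning two opposite ones into an
    equation needs properness of every matrix cone, whereas it is assumed for $V^+$ alone; it is
    recovered by compressing to columns. Continuity refers to norms that are infima. The estimates
    therefore handle the admissible constants themselves, through the predicate [bnd]: these pass
    through sums and contractions by positivity alone. That an admissible constant exists at all has
    to be derived from the order unit, which controls only self-adjoint elements of $V$. Positions
    are the other obstacle: padding, reordering and rebracketing change the size of a matrix and
    hence its type. They are all expressed by [push f u], the placement of [u] along an injection
    [f] of indices, so that no cast survives in the homotopy arguments. *)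

(** * Adjoints and operator norms of complex matrices *)

Section ScalarMatrices.
Variable R : realType.
Local Notation C := R[i].

Lemma adjmxE m n (a : 'M[C]_(m, n)) i j : adjmx a i j = (a j i)^*%R.
Proof. by rewrite !mxE. Qed.

Lemma adjmxK m n (a : 'M[C]_(m, n)) : adjmx (adjmx a) = a.
Proof. by apply/matrixP => i j; rewrite !adjmxE conjCK. Qed.

Lemma adjmxD m n (a b : 'M[C]_(m, n)) : adjmx (a + b) = adjmx a + adjmx b.
Proof. by rewrite /adjmx linearD /= map_mxD. Qed.

Lemma adjmxZ m n c (a : 'M[C]_(m, n)) : adjmx (c *: a) = c^*%R *: adjmx a.
Proof. by apply/matrixP => i j; rewrite !mxE rmorphM. Qed.

Lemma adjmx1 n : adjmx (1%:M : 'M[C]_n) = 1%:M.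
Proof. by apply/matrixP => i j; rewrite !mxE eq_sym conjC_nat. Qed.

Lemma adjmxM m n p (a : 'M[C]_(m, n)) (b : 'M[C]_(n, p)) :
  adjmx (a *m b) = adjmx b *m adjmx a.
Proof. by rewrite /adjmx trmx_mul map_mxM. Qed.

Lemma conj_i : ('i%C : C)^*%R = - 'i%C.
Proof. by change ('i%C^* = - 'i%C :> R[i])%C; simpc. Qed.

Lemma conj_real (x : R) : (x%:C : C)^*%R = x%:C.
Proof. exact: conjc_real. Qed.

(** Written through $x^*x$, the Euclidean norm is visibly invariant under every $a$ with
    $a^*a=1$. *)
Lemma euclidE n (x : 'cV[C]_n) :
  euclid x = Num.sqrt (complex.Re ((adjmx x *m x) 0 0)).
Proof.
rewrite /euclid mxE raddf_sum; congr Num.sqrt; apply: eq_bigr => k _.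
by rewrite adjmxE; case: (x k 0) => a b /=; ring.
Qed.

Lemma opnorm_isometry m n (a : 'M[C]_(m, n)) : adjmx a *m a = 1%:M ->
  opnorm a <= 1.
Proof.
move=> aa; apply: ge_sup.
  exists (euclid (a *m 0)); exists 0 => //=.
  by rewrite /euclid big1 ?sqrtr0 // => i _; rewrite mxE /= !expr0n addr0.
move=> _ [x /= x1 <-]; rewrite euclidE adjmxM -mulmxA (mulmxA _ a) aa mul1mx.
by rewrite -euclidE.
Qed.

End ScalarMatrices.

(** * Two-sided multiplication of matrices over $V$ by scalar matrices *)

Section Sandwich.
Variables (R : realType) (V : lmodType R[i]).
Local Notation C := R[i].

Lemma lmulmxA m n p q (a : 'M[C]_(m, n)) (b : 'M[C]_(n, p)) (v : 'M[V]_(p, q)) :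
  lmulmx a (lmulmx b v) = lmulmx (a *m b) v.
Proof.
apply/matrixP => i j; rewrite !mxE.
under eq_bigr do rewrite mxE scaler_sumr.
rewrite exchange_big /=; apply: eq_bigr => k _.
by rewrite mxE scaler_suml; apply: eq_bigr => l _; rewrite scalerA.
Qed.

Lemma rmulmxA m n p q (v : 'M[V]_(m, n)) (a : 'M[C]_(n, p)) (b : 'M[C]_(p, q)) :
  rmulmx (rmulmx v a) b = rmulmx v (a *m b).
Proof.
apply/matrixP => i j; rewrite !mxE.
under eq_bigr do rewrite mxE scaler_sumr.
rewrite exchange_big /=; apply: eq_bigr => k _.
rewrite mxE scaler_suml; apply: eq_bigr => l _.
by rewrite scalerA mulrC.
Qed.

Lemma lrmulmxA m n p q (a : 'M[C]_(m, n)) (v : 'M[V]_(n, p)) (b : 'M[C]_(p, q)) :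
  lmulmx a (rmulmx v b) = rmulmx (lmulmx a v) b.
Proof.
apply/matrixP => i j; rewrite !mxE.
under eq_bigr do rewrite mxE scaler_sumr.
rewrite exchange_big /=; apply: eq_bigr => k _.
rewrite mxE scaler_sumr; apply: eq_bigr => l _.
by rewrite !scalerA mulrC.
Qed.

Lemma lmul1mx m n (v : 'M[V]_(m, n)) : lmulmx 1%:M v = v.
Proof.
apply/matrixP => i j; rewrite mxE (bigD1 i) //= big1 ?addr0 => [|k ki].
  by rewrite mxE eqxx scale1r.
by rewrite mxE eq_sym (negPf ki) scale0r.
Qed.

Lemma rmulmx1 m n (v : 'M[V]_(m, n)) : rmulmx v 1%:M = v.
Proof.
apply/matrixP => i j; rewrite mxE (bigD1 j) //= big1 ?addr0 => [|k kj].
  by rewrite mxE eqxx scale1r.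
by rewrite mxE (negPf kj) scale0r.
Qed.

(** The two outer factors may differ: polarization and the off-diagonal blocks in the norm criterion
    both need $a^*vb$ with $a\ne b$. *)
Definition compr m n p q (a : 'M[C]_(m, n)) (v : 'M[V]_(m, p)) (b : 'M[C]_(p, q))
  : 'M[V]_(n, q) := rmulmx (lmulmx (adjmx a) v) b.

Lemma comprE m n p q (a : 'M[C]_(m, n)) (v : 'M[V]_(m, p)) (b : 'M[C]_(p, q)) i j :
  compr a v b i j = \sum_k \sum_l (b l j * (a k i)^*%R) *: v k l.
Proof.
rewrite mxE exchange_big /=; apply: eq_bigr => l _; rewrite mxE scaler_sumr.
by apply: eq_bigr => k _; rewrite adjmxE scalerA.
Qed.

Lemma compr_compr m n p q r s (a : 'M[C]_(m, n)) (v : 'M[V]_(m, p))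
    (b : 'M[C]_(p, q)) (c : 'M[C]_(n, r)) (d : 'M[C]_(q, s)) :
  compr c (compr a v b) d = compr (a *m c) v (b *m d).
Proof. by rewrite /compr lrmulmxA rmulmxA lmulmxA adjmxM. Qed.

Lemma compr1 m n (v : 'M[V]_(m, n)) : compr 1%:M v 1%:M = v.
Proof. by rewrite /compr adjmx1 lmul1mx rmulmx1. Qed.

Lemma comprD m n p q (a : 'M[C]_(m, n)) (v w : 'M[V]_(m, p)) (b : 'M[C]_(p, q)) :
  compr a (v + w) b = compr a v b + compr a w b.
Proof.
apply/matrixP => i j; rewrite comprE [RHS]mxE !comprE -big_split.
apply: eq_bigr => k _.
by rewrite -big_split; apply: eq_bigr => l _; rewrite mxE scalerDr.
Qed.

Lemma compr0 m n p q (a : 'M[C]_(m, n)) (b : 'M[C]_(p, q)) :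
  compr a (0 : 'M[V]_(m, p)) b = 0.
Proof. by apply: (@addrI _ (compr a 0 b)); rewrite -comprD !addr0. Qed.

Lemma comprN m n p q (a : 'M[C]_(m, n)) (v : 'M[V]_(m, p)) (b : 'M[C]_(p, q)) :
  compr a (- v) b = - compr a v b.
Proof. by apply: (@addrI _ (compr a v b)); rewrite -comprD !subrr compr0. Qed.

Lemma comprB m n p q (a : 'M[C]_(m, n)) (v w : 'M[V]_(m, p)) (b : 'M[C]_(p, q)) :
  compr a (v - w) b = compr a v b - compr a w b.
Proof. by rewrite comprD comprN. Qed.

Lemma comprZ m n p q (a : 'M[C]_(m, n)) c (v : 'M[V]_(m, p)) (b : 'M[C]_(p, q)) :
  compr a (scalemxV c v) b = scalemxV c (compr a v b).
Proof.
apply/matrixP => i j; rewrite comprE [RHS]mxE !comprE scaler_sumr.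
apply: eq_bigr => k _.
rewrite scaler_sumr; apply: eq_bigr => l _.
by rewrite mxE !scalerA mulrC.
Qed.

Lemma comprDl m n p q (a a' : 'M[C]_(m, n)) (v : 'M[V]_(m, p)) (b : 'M[C]_(p, q)) :
  compr (a + a') v b = compr a v b + compr a' v b.
Proof.
apply/matrixP => i j; rewrite comprE [RHS]mxE !comprE -big_split.
apply: eq_bigr => k _.
rewrite -big_split; apply: eq_bigr => l _.
by rewrite mxE rmorphD mulrDr scalerDl.
Qed.

Lemma comprDr m n p q (a : 'M[C]_(m, n)) (v : 'M[V]_(m, p)) (b b' : 'M[C]_(p, q)) :
  compr a v (b + b') = compr a v b + compr a v b'.
Proof.
apply/matrixP => i j; rewrite comprE [RHS]mxE !comprE -big_split.
apply: eq_bigr => k _.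
rewrite -big_split; apply: eq_bigr => l _.
by rewrite mxE mulrDl scalerDl.
Qed.

Lemma comprZl m n p q (a : 'M[C]_(m, n)) c (v : 'M[V]_(m, p)) (b : 'M[C]_(p, q)) :
  compr (c *: a) v b = scalemxV c^*%R (compr a v b).
Proof.
apply/matrixP => i j; rewrite comprE [RHS]mxE !comprE scaler_sumr.
apply: eq_bigr => k _.
rewrite scaler_sumr; apply: eq_bigr => l _.
by rewrite mxE scalerA rmorphM mulrCA.
Qed.

Lemma comprZr m n p q (a : 'M[C]_(m, n)) c (v : 'M[V]_(m, p)) (b : 'M[C]_(p, q)) :
  compr a v (c *: b) = scalemxV c (compr a v b).
Proof.
apply/matrixP => i j; rewrite comprE [RHS]mxE !comprE scaler_sumr.
apply: eq_bigr => k _.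
rewrite scaler_sumr; apply: eq_bigr => l _.
by rewrite mxE scalerA mulrA.
Qed.

Lemma comprNl m n p q (a : 'M[C]_(m, n)) (v : 'M[V]_(m, p)) (b : 'M[C]_(p, q)) :
  compr (- a) v b = - compr a v b.
Proof.
by rewrite -scaleN1r comprZl rmorphN rmorph1; apply/matrixP => i j;
  rewrite [LHS]mxE [RHS]mxE scaleN1r.
Qed.

Lemma comprNr m n p q (a : 'M[C]_(m, n)) (v : 'M[V]_(m, p)) (b : 'M[C]_(p, q)) :
  compr a v (- b) = - compr a v b.
Proof.
by rewrite -scaleN1r comprZr; apply/matrixP => i j;
  rewrite [LHS]mxE [RHS]mxE scaleN1r.
Qed.

Lemma compr0l m n p q (v : 'M[V]_(m, p)) (b : 'M[C]_(p, q)) :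
  compr (0 : 'M[C]_(m, n)) v b = 0.
Proof. by apply: (@addrI _ (compr 0 v b)); rewrite -comprDl !addr0. Qed.

Lemma compr0r m n p q (a : 'M[C]_(m, n)) (v : 'M[V]_(m, p)) :
  compr a v (0 : 'M[C]_(p, q)) = 0.
Proof. by apply: (@addrI _ (compr a v 0)); rewrite -comprDr !addr0. Qed.

Lemma compr_scalar m n q (a : 'M[C]_(m, n)) (v : V) (b : 'M[C]_(m, q)) :
  compr a v%:M b = map_mx ( *:%R^~ v) (adjmx a *m b).
Proof.
apply/matrixP => i j; rewrite comprE !mxE scaler_suml; apply: eq_bigr => k _.
rewrite (bigD1 k) //= big1 ?addr0 => [|l lk].
  by rewrite mxE eqxx mulr1n adjmxE mulrC.
by rewrite mxE eq_sym (negPf lk) mulr0n scaler0.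
Qed.

Lemma scalemxVD m n c (v w : 'M[V]_(m, n)) :
  scalemxV c (v + w) = scalemxV c v + scalemxV c w.
Proof. by apply/matrixP => i j; rewrite !mxE scalerDr. Qed.

Lemma scalemxVDl m n c d (v : 'M[V]_(m, n)) :
  scalemxV (c + d) v = scalemxV c v + scalemxV d v.
Proof. by apply/matrixP => i j; rewrite !mxE scalerDl. Qed.

Lemma scalemxVA m n c d (v : 'M[V]_(m, n)) :
  scalemxV c (scalemxV d v) = scalemxV (c * d) v.
Proof. by apply/matrixP => i j; rewrite !mxE scalerA. Qed.

Lemma scalemxV1 m n (v : 'M[V]_(m, n)) : scalemxV 1 v = v.
Proof. by apply/matrixP => i j; rewrite !mxE scale1r. Qed.

Lemma scalemxVN m n c (v : 'M[V]_(m, n)) : scalemxV (- c) v = - scalemxV c v.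
Proof. by apply/matrixP => i j; rewrite !mxE scaleNr. Qed.

Lemma scalemxV0 m n c : scalemxV c (0 : 'M[V]_(m, n)) = 0.
Proof. by apply/matrixP => i j; rewrite !mxE scaler0. Qed.

Lemma compr_block m1 m2 n1 n2 (a : 'M[C]_(m1, n1)) (b : 'M[C]_(m2, n2))
    (u : 'M[V]_m1) (v : 'M[V]_(m1, m2)) (w : 'M[V]_(m2, m1)) (x : 'M[V]_m2) :
  compr (block_mx a 0 0 b) (block_mx u v w x) (block_mx a 0 0 b) =
  block_mx (compr a u a) (compr a v b) (compr b w a) (compr b x b).
Proof.
apply/matrixP => i j.
rewrite comprE big_split_ord /=.
case: (split_ordP i) => i' ->; case: (split_ordP j) => j' ->;
rewrite ?(block_mxEul, block_mxEur, block_mxEdl, block_mxEdr) comprE.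
- rewrite [X in _ + X]big1 ?addr0 => [|k _]; last first.
    by rewrite big1 // => l _; rewrite block_mxEdl !mxE conjC0 mulr0 scale0r.
  apply: eq_bigr => k _; rewrite big_split_ord /= [X in _ + X]big1 ?addr0.
    by apply: eq_bigr => l _; rewrite !block_mxEul.
  by move=> l _; rewrite block_mxEdl !mxE mul0r scale0r.
- rewrite [X in _ + X]big1 ?addr0 => [|k _]; last first.
    by rewrite big1 // => l _; rewrite block_mxEdl !mxE conjC0 mulr0 scale0r.
  apply: eq_bigr => k _; rewrite big_split_ord /= [X in X + _]big1 ?add0r.
    by apply: eq_bigr => l _; rewrite block_mxEul block_mxEur block_mxEdr.
  by move=> l _; rewrite block_mxEur !mxE mul0r scale0r.
- rewrite [X in X + _]big1 ?add0r => [|k _]; last first.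
    by rewrite big1 // => l _; rewrite block_mxEur !mxE conjC0 mulr0 scale0r.
  apply: eq_bigr => k _; rewrite big_split_ord /= [X in _ + X]big1 ?addr0.
    by apply: eq_bigr => l _; rewrite block_mxEul block_mxEdl block_mxEdr.
  by move=> l _; rewrite block_mxEdl !mxE mul0r scale0r.
- rewrite [X in X + _]big1 ?add0r => [|k _]; last first.
    by rewrite big1 // => l _; rewrite block_mxEur !mxE conjC0 mulr0 scale0r.
  apply: eq_bigr => k _; rewrite big_split_ord /= [X in X + _]big1 ?add0r.
    by apply: eq_bigr => l _; rewrite !block_mxEdr.
  by move=> l _; rewrite block_mxEur !mxE mul0r scale0r.
Qed.

End Sandwich.

(** * Properness of the matrix cones and positivity of $e^n$ *)

Section MatrixOrder.
Variables (R : realType) (V : matrixOrderUnitType R).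
Local Notation C := R[i].
Local Notation e := (@ounitmx R V).

Lemma star0 : star (0 : V) = 0.
Proof. by apply: (@addrI V (star 0)); rewrite -starD !addr0. Qed.

Lemma star_sum I (r : seq I) (F : I -> V) :
  star (\sum_(i <- r) F i) = \sum_(i <- r) star (F i).
Proof. by apply: (big_morph _ (@starD _ V) star0). Qed.

Lemma starmxD m n (v w : 'M[V]_(m, n)) : starmx (v + w) = starmx v + starmx w.
Proof. by apply/matrixP => i j; rewrite !mxE starD. Qed.

Lemma starmx0 m n : starmx (0 : 'M[V]_(m, n)) = 0.
Proof. by apply/matrixP => i j; rewrite !mxE star0. Qed.

Lemma starmx_scale m n c (v : 'M[V]_(m, n)) :
  starmx (scalemxV c v) = scalemxV c^*%R (starmx v).
Proof. by apply/matrixP => i j; rewrite !mxE starZ. Qed.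

Lemma starmx_compr m n p q (a : 'M[C]_(m, n)) (v : 'M[V]_(m, p))
    (b : 'M[C]_(p, q)) :
  starmx (compr a v b) = compr b (starmx v) a.
Proof.
apply/matrixP => i j; rewrite [LHS]mxE [in LHS]mxE !comprE exchange_big star_sum.
apply: eq_bigr => k _; rewrite star_sum; apply: eq_bigr => l _.
rewrite [in RHS]mxE [in RHS]mxE starZ rmorphM mulrC.
by congr (_ * _ *: _); exact: conjCK.
Qed.

Lemma pos_compr m n (a : 'M[C]_(m, n)) (v : 'M[V]_m) :
  (0 < m)%N -> (0 < n)%N -> pos m v -> pos n (compr a v a).
Proof. by move=> m0 n0; exact: pos_compress. Qed.

Lemma pos_sum n I (r : seq I) (P : pred I) (F : I -> 'M[V]_n) : (0 < n)%N ->
  (forall i, P i -> pos n (F i)) -> pos n (\sum_(i <- r | P i) F i).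
Proof. by move=> n0 F0; apply: big_ind => //; [exact: pos0|move=> *; exact: posD]. Qed.

(* Polarization. *)
Lemma compr_diag_eq0 n (v : 'M[V]_n) :
  (forall x : 'cV[C]_n, compr x v x = 0) -> v = 0.
Proof.
move=> v0.
have B (x y : 'cV[C]_n) : compr x v y + compr y v x = 0.
  by have := v0 (x + y); rewrite comprDl !comprDr !v0 addr0 add0r.
have D (x y : 'cV[C]_n) : compr x v y = 0.
  have := B x ('i%C *: y); rewrite comprZr comprZl conj_i scalemxVN.
  have -> : compr y v x = - compr x v y by apply/eqP; rewrite -addr_eq0 addrC B.
  have -> (w : 'M[V]_1) : - scalemxV 'i%C (- w) = scalemxV 'i%C w.
    by apply/matrixP => i j; rewrite !mxE scalerN opprK.
  rewrite -scalemxVDl => /(congr1 (scalemxV ('i%C + 'i%C)^-1)).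
  rewrite scalemxVA scalemxV0 mulVf ?scalemxV1 //.
  by rewrite -mulr2n mulrn_eq0 /= neq0Ci.
apply/matrixP => i j; rewrite mxE.
have := D (delta_mx i 0) (delta_mx j 0) => /matrixP /(_ 0 0).
rewrite comprE mxE (bigD1 i) //= (bigD1 j) //= !mxE !eqxx /= conjC1 mulr1 scale1r.
rewrite big1 ?addr0 => [|l lj]; last by rewrite !mxE (negPf lj) mul0r scale0r.
rewrite big1 ?addr0 // => k ki; rewrite big1 // => l _.
by rewrite !mxE (negPf ki) conjC0 mulr0 scale0r.
Qed.

(** Compression by a column $x$ gives a $1\times1$ matrix whose entry lies in $V^+\cap(-V^+)$, so
    $x^*vx=0$ for every $x$. *)
Lemma pos_proper n (v : 'M[V]_n) : (0 < n)%N ->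
  pos n v -> pos n (- v) -> v = 0.
Proof.
move=> n0 p q; apply: compr_diag_eq0 => x.
have P1 : compr x v x = (compr x v x 0 0)%:M by exact: mx11_scalar.
rewrite P1 (_ : compr x v x 0 0 = 0) ?raddf0 //; apply: posV_proper.
  by rewrite /posV /= -P1; exact: pos_compr.
rewrite /posV /= raddfN /= -P1 -comprN; exact: pos_compr.
Qed.

Lemma lemx_trans n (u v w : 'M[V]_n) : (0 < n)%N ->
  lemx u v -> lemx v w -> lemx u w.
Proof.
move=> n0 uv vw; rewrite /lemx.
by have := posD n _ _ n0 uv vw; rewrite addrC addrA subrK.
Qed.

Lemma lemx_anti n (u v : 'M[V]_n) : (0 < n)%N -> lemx u v -> lemx v u -> u = v.
Proof.
move=> n0 uv vu; apply/eqP; rewrite -subr_eq0; apply/eqP.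
by apply: (pos_proper n0); rewrite ?opprB.
Qed.

(** The matrix is the sum over $i$ of $d_i$ times the compression of the order unit by the $i$-th
    unit row. *)
Lemma pos_diag n (d : 'I_n -> R) : (0 < n)%N -> (forall i, 0 <= d i) ->
  pos n (map_mx ( *:%R^~ (ounit : V)) (diag_mx (\row_i (d i)%:C))).
Proof.
move=> n0 d0.
have -> : map_mx ( *:%R^~ (ounit : V)) (diag_mx (\row_i (d i)%:C)) =
  \sum_i scalemxV (d i)%:C
    (compr (delta_mx 0 i : 'M[C]_(1, n)) (ounit : V)%:M (delta_mx 0 i)).
  under eq_bigr do rewrite compr_scalar.
  apply/matrixP => i j; rewrite summxE (bigD1 i) //= big1 => [|k ki].
    rewrite !mxE big_ord1 !mxE !eqxx conjC1 mul1r addr0.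
    case: eqVneq => _; first by rewrite mulr1n scale1r.
    by rewrite mulr0n !scale0r scaler0.
  rewrite !mxE big_ord1 !mxE.
  by rewrite (eq_sym i) (negPf ki) andbF conjC0 mul0r scale0r scaler0.
apply: pos_sum => // i _; apply: posZ => //.
by apply: pos_compr => //; exact: ounit_pos.
Qed.

Lemma ounitmxE n : e n = map_mx ( *:%R^~ (ounit : V)) 1%:M.
Proof.
apply/matrixP => i j; rewrite !mxE.
by case: eqP; rewrite ?mulr1n ?scale1r // mulr0n scale0r.
Qed.

Lemma pos_ounit n : (0 < n)%N -> pos n (e n).
Proof.
move=> n0; rewrite ounitmxE.
have -> : 1%:M = diag_mx (\row_i 1%:C) :> 'M[C]_n.
  by apply/matrixP => i j; rewrite !mxE.
by apply: pos_diag.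
Qed.

Lemma starmx_ounit n : (0 < n)%N -> starmx (e n) = e n.
Proof. by move=> n0; exact: (pos_sa n n0 _ (pos_ounit n0)). Qed.

Lemma compr_ounit m n (a : 'M[C]_(m, n)) : adjmx a *m a = 1%:M ->
  compr a (e m) a = e n.
Proof. by move=> aa; rewrite compr_scalar aa -ounitmxE. Qed.

End MatrixOrder.

(** * Behaviour of the absolute value under scalar unitaries *)

Section AbsoluteValue.
Variables (R : realType) (V : absMatrixOrderUnitType R).
Local Notation C := R[i].
Local Notation e := (@ounitmx R V).

Lemma absmx_id n (u : 'M[V]_n) : (0 < n)%N -> pos n u -> absmx u = u.
Proof. by move=> n0; exact: (ao_id (absmx_absolutely_ordered n n0)). Qed.

Lemma absmx_isometry m n r q (a : 'M[C]_(r, m)) (v : 'M[V]_(m, n))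
    (b : 'M[C]_(n, q)) :
  (0 < m)%N -> (0 < n)%N -> (0 < r)%N -> (0 < q)%N -> adjmx a *m a = 1%:M ->
  lemx (absmx (rmulmx (lmulmx a v) b)) (absmx (rmulmx (absmx v) b)).
Proof.
move=> m0 n0 r0 q0 aa.
apply: lemx_trans (absmxM m n r q a v b m0 n0 r0 q0) _ => //.
set w := absmx (rmulmx (absmx v) b).
have -> : lemx (scalemxV (opnorm a)%:C w) w = pos q (scalemxV (1 - opnorm a)%:C w).
  rewrite /lemx; congr pos; rewrite rmorphB /= scalemxVDl scalemxVN.
  by rewrite scalemxV1.
apply: posZ => //; last exact: absmx_pos.
by rewrite subr_ge0 opnorm_isometry.
Qed.

Section Unitary.
Variables (m k : nat) (U : 'M[C]_(m, k)).
Hypotheses (m0 : (0 < m)%N) (k0 : (0 < k)%N).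
Hypotheses (UU : adjmx U *m U = 1%:M) (UU' : U *m adjmx U = 1%:M).

Let UU'' : adjmx (adjmx U) *m adjmx U = 1%:M. Proof. by rewrite adjmxK. Qed.

(** The matrix $U^*pU$ is positive, hence its own absolute value, and $pU$ and $U^*pU$ arise from
    each other by an isometry on the left. *)
Lemma absmx_posr (p : 'M[V]_m) : pos m p -> absmx (rmulmx p U) = compr U p U.
Proof.
move=> pp; have pc : pos k (compr U p U) by exact: pos_compr.
have bp : pos k (absmx (rmulmx p U)) by exact: absmx_pos.
apply: lemx_anti => //.
  have := absmx_isometry (compr U p U) 1%:M k0 k0 m0 k0 UU.
  by rewrite !rmulmx1 (absmx_id k0 pc) (absmx_id k0 pc) /compr -lrmulmxA lmulmxA
    UU' lmul1mx.
have := absmx_isometry (rmulmx p U) 1%:M m0 k0 k0 k0 UU''.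
by rewrite !rmulmx1 (absmx_id k0 bp) lrmulmxA -/(compr U p U) (absmx_id k0 pc).
Qed.
End Unitary.

(** One inequality is the axiom with trivial left factor. The other uses it for $xU$ and $U^*$,
    which gives $|x|\le U|xU|U^*$, and then compresses by $U$. *)
Lemma absmxr_unitary m k (U : 'M[C]_(m, k)) (x : 'M[V]_m) :
  (0 < m)%N -> (0 < k)%N -> adjmx U *m U = 1%:M -> U *m adjmx U = 1%:M ->
  absmx (rmulmx x U) = compr U (absmx x) U.
Proof.
move=> m0 k0 UU UU'; have ax : pos m (absmx x) by exact: absmx_pos.
have axU : pos k (absmx (rmulmx x U)) by exact: absmx_pos.
apply: lemx_anti => //.
  have := absmx_isometry x U m0 m0 m0 k0 (a := 1%:M).
  by rewrite adjmx1 mul1mx lmul1mx (absmx_posr _ _ _ _ ax) // => /(_ erefl).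
have := absmx_isometry (rmulmx x U) (adjmx U) m0 k0 m0 m0 (a := 1%:M).
rewrite adjmx1 mul1mx lmul1mx rmulmxA UU' rmulmx1 (absmx_posr _ _ _ _ axU) ?adjmxK //.
move=> /(_ erefl) h; have := pos_compr U m0 k0 h.
by rewrite comprB compr_compr UU compr1.
Qed.

(** A unitary on the left does not change the absolute value, so $|U^*xU|=|xU|$. *)
Lemma absmx_unitary m k (U : 'M[C]_(m, k)) (x : 'M[V]_m) :
  (0 < m)%N -> (0 < k)%N -> adjmx U *m U = 1%:M -> U *m adjmx U = 1%:M ->
  absmx (compr U x U) = compr U (absmx x) U.
Proof.
move=> m0 k0 UU UU'; rewrite -absmxr_unitary //.
rewrite /compr -lrmulmxA; set y := rmulmx x U.
have ay : pos k (absmx y) by exact: absmx_pos.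
have az : pos k (absmx (lmulmx (adjmx U) y)) by exact: absmx_pos.
apply: lemx_anti => //.
  have := absmx_isometry y 1%:M m0 k0 k0 k0 (a := adjmx U).
  by rewrite adjmxK !rmulmx1 (absmx_id k0 ay); apply.
have := absmx_isometry (lmulmx (adjmx U) y) 1%:M k0 k0 m0 k0 UU.
by rewrite lmulmxA UU' lmul1mx !rmulmx1 (absmx_id k0 az).
Qed.

Lemma partial_unitary_unitary m k (U : 'M[C]_(m, k)) (u : 'M[V]_m) :
  (0 < m)%N -> (0 < k)%N -> adjmx U *m U = 1%:M -> U *m adjmx U = 1%:M ->
  partial_unitary u -> partial_unitary (compr U u U).
Proof.
move=> m0 k0 UU UU' [us [ps pa]]; split.
  by rewrite starmx_compr !absmx_unitary // us.
rewrite absmx_unitary //; split; first by rewrite starmx_compr ps.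
rewrite -(compr_ounit _ UU) mulr2n -comprD -comprB -mulr2n absmx_unitary //.
by rewrite pa.
Qed.

Lemma partial_unitary0 n : (0 < n)%N -> partial_unitary (0 : 'M[V]_n).
Proof.
move=> n0; have p0 : pos n (0 : 'M[V]_n) by exact: pos0.
split; first by rewrite starmx0.
rewrite absmx_id //; split; first exact: starmx0.
have -> : 0 *+ 2 - e n = scalemxV (-1)%:C (e n).
  by rewrite mul0rn sub0r rmorphN /= scalemxVN scalemxV1.
rewrite (ao_scale (absmx_absolutely_ordered n n0)); last exact: starmx_ounit.
by rewrite normrN1 scalemxV1 absmx_id //; exact: pos_ounit.
Qed.

End AbsoluteValue.

(** * Placing a matrix at prescribed indices by 0-1 matrices *)

Section Selection.
Variables (R : realType) (V : lmodType R[i]).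
Local Notation C := R[i].

Definition selmx m k (f : 'I_m -> 'I_k) : 'M[C]_(m, k) :=
  \matrix_(i, j) (f i == j)%:R.

Lemma selmx_comp m n k (f : 'I_m -> 'I_n) (g : 'I_n -> 'I_k) :
  selmx f *m selmx g = selmx (g \o f).
Proof.
apply/matrixP => i j; rewrite !mxE (bigD1 (f i)) //= !mxE eqxx mul1r.
by rewrite big1 ?addr0 // => l lf; rewrite !mxE eq_sym (negPf lf) mul0r.
Qed.

Lemma selmx_adjr m k (f : 'I_m -> 'I_k) : injective f ->
  selmx f *m adjmx (selmx f) = 1%:M.
Proof.
move=> fI; apply/matrixP => i j; rewrite !mxE (bigD1 (f i)) //= !mxE eqxx mul1r.
rewrite big1 ?addr0 => [|l lf]; last by rewrite !mxE eq_sym (negPf lf) mul0r.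
by rewrite conjC_nat (inj_eq fI) eq_sym.
Qed.

Lemma selmx_adjl m k (f : 'I_m -> 'I_k) : injective f ->
  adjmx (selmx f) *m selmx f = diag_mx (\row_j (j \in codom f)%:R%:C).
Proof.
move=> fI; apply/matrixP => i j; rewrite !mxE; case: (boolP (i \in codom f)).
  case/codomP => l ->; rewrite (bigD1 l) //= !mxE eqxx conjC1 mul1r.
  rewrite big1 ?addr0 => [|h hl]; first by case: eqP.
  by rewrite !mxE (inj_eq fI) (negPf hl) conjC0 mul0r.
move=> h; rewrite mul0rn big1 // => l _; rewrite !mxE.
have /negPf -> : f l != i by apply: contraNneq h => <-; exact: codom_f.
by rewrite conjC0 mul0r.
Qed.

Lemma compr_selE m n p q (f : 'I_m -> 'I_p) (g : 'I_n -> 'I_q) (v : 'M[V]_(m, n))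
    i j : injective f -> injective g ->
  compr (selmx f) v (selmx g) (f i) (g j) = v i j.
Proof.
move=> fI gI; rewrite comprE (bigD1 i) //= [X in _ + X]big1 ?addr0 => [|k ki].
  rewrite (bigD1 j) //= [X in _ + X]big1 ?addr0 => [|l lj].
    by rewrite !mxE !eqxx conjC1 mulr1 scale1r.
  by rewrite !mxE (inj_eq gI) (negPf lj) mul0r scale0r.
by rewrite big1 // => l _; rewrite !mxE (inj_eq fI) (negPf ki) conjC0 mulr0 scale0r.
Qed.

Lemma compr_sel0 m n p q (f : 'I_m -> 'I_p) (g : 'I_n -> 'I_q) (v : 'M[V]_(m, n))
    i j : (i \notin codom f) || (j \notin codom g) ->
  compr (selmx f) v (selmx g) i j = 0.
Proof.
move=> h; rewrite comprE big1 // => k _; rewrite big1 // => l _; rewrite !mxE.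
case/orP: h => h.
  have /negPf -> : f k != i by apply: contraNneq h => <-; exact: codom_f.
  by rewrite conjC0 mulr0 scale0r.
have /negPf -> : g l != j by apply: contraNneq h => <-; exact: codom_f.
by rewrite mul0r scale0r.
Qed.

(** For injective [f] the entry of [u] at [i], [j] moves to [f i], [f j], and all other entries are
    zero. Being a compression, it composes and interacts with positivity without entrywise work. *)
Definition push m k (f : 'I_m -> 'I_k) (u : 'M[V]_m) : 'M[V]_k :=
  compr (selmx f) u (selmx f).

Lemma pushE m k (f : 'I_m -> 'I_k) (u : 'M[V]_m) i j : injective f ->
  push f u (f i) (f j) = u i j.
Proof. by move=> fI; exact: compr_selE. Qed.

Lemma push0E m k (f : 'I_m -> 'I_k) (u : 'M[V]_m) i j :
  (i \notin codom f) || (j \notin codom f) -> push f u i j = 0.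
Proof. exact: compr_sel0. Qed.

Lemma push_comp m n k (f : 'I_m -> 'I_n) (g : 'I_n -> 'I_k) (u : 'M[V]_m) :
  push g (push f u) = push (g \o f) u.
Proof. by rewrite /push compr_compr selmx_comp. Qed.

Lemma pushP m k (f : 'I_m -> 'I_k) (u : 'M[V]_m) (v : 'M[V]_k) : injective f ->
  (forall i j, v (f i) (f j) = u i j) ->
  (forall i j, (i \notin codom f) || (j \notin codom f) -> v i j = 0) ->
  v = push f u.
Proof.
move=> fI vf v0; apply/matrixP => i j.
have [h|] := boolP ((i \notin codom f) || (j \notin codom f)).
  by rewrite push0E // v0.
rewrite negb_or !negbK => /andP[/codomP[i' ->] /codomP[j' ->]].
by rewrite pushE // vf.
Qed.

Lemma push_id n (u : 'M[V]_n) : push id u = u.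
Proof. by apply/esym/pushP => // i j; rewrite !(codom_f id). Qed.

Lemma codom_lshift m n (i : 'I_m) : lshift n i \in codom (lshift n).
Proof. exact: codom_f. Qed.

Lemma dsum0_push m n (u : 'M[V]_m) :
  dsum u (0 : 'M[V]_n) = push (lshift n) u.
Proof.
apply: pushP => [|i j|i j]; first exact: lshift_inj.
  by rewrite /dsum block_mxEul.
case: (split_ordP i) => i' ->; case: (split_ordP j) => j' ->;
rewrite /dsum ?codom_lshift //= ?(block_mxEur, block_mxEdl, block_mxEdr) ?mxE //.
Qed.

End Selection.

(** * Admissible constants for the matrix norms *)

Section Bounds.
Variables (R : realType) (V : matrixOrderUnitType R).
Local Notation C := R[i].
Local Notation e := (@ounitmx R V).

(** Admissibility of [k] in the infimum defining [normmx], without the condition [0 < k], so that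
    zero summands and zero coefficients need no separate case. *)
Definition bnd n (k : R) (v : 'M[V]_n) : Prop :=
  pos (n + n) (block_mx (scalemxV k%:C (e n)) v
                        (starmx v) (scalemxV k%:C (e n))).

Lemma gt0_dbl n : (0 < n)%N -> (0 < n + n)%N.
Proof. by rewrite addn_gt0 => ->. Qed.

Lemma bndD n k l (u v : 'M[V]_n) : (0 < n)%N -> bnd k u -> bnd l v ->
  bnd (k + l) (u + v).
Proof.
move=> n0 bu bv; have := posD _ _ _ (gt0_dbl n0) bu bv.
by rewrite add_block_mx -starmxD -scalemxVDl -rmorphD.
Qed.

Lemma compr_row n p (a b : 'M[C]_(n, p)) (v : 'M[V]_n) :
  compr (row_mx a b) v (row_mx a b) =
  block_mx (compr a v a) (compr a v b) (compr b v a) (compr b v b).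
Proof.
apply/matrixP => i j; rewrite comprE.
case: (split_ordP i) => i' ->; case: (split_ordP j) => j' ->;
rewrite ?(block_mxEul, block_mxEur, block_mxEdl, block_mxEdr) comprE;
apply: eq_bigr => k _; apply: eq_bigr => l _;
by rewrite ?(row_mxEl, row_mxEr).
Qed.

Lemma pos_block_diag n (p q : 'M[V]_n) : (0 < n)%N -> pos n p -> pos n q ->
  pos (n + n) (block_mx p 0 0 q).
Proof.
move=> n0 pp pq; have nn := gt0_dbl n0.
have := posD _ _ _ nn (pos_compr (row_mx 1%:M 0) n0 nn pp)
                      (pos_compr (row_mx 0 1%:M) n0 nn pq).
rewrite !compr_row add_block_mx !compr1.
by rewrite !compr0l !compr0r !addr0 !add0r.
Qed.

(** Compressing the block matrix by $\mathrm{diag}(a,b)$ leaves $k\,a^*e^ma$ and $k\,b^*e^mb$ on the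
    diagonal; adding [k] times the two positive defects restores $ke^n$. *)
Lemma bnd_compr m n k (a b : 'M[C]_(m, n)) (v : 'M[V]_m) :
  (0 < m)%N -> (0 < n)%N -> 0 <= k ->
  pos n (e n - compr a (e m) a) -> pos n (e n - compr b (e m) b) ->
  bnd k v -> bnd k (compr a v b).
Proof.
move=> m0 n0 k0 pa pb bv; have nn := gt0_dbl n0; have mm := gt0_dbl m0.
have := posD _ _ _ nn (pos_compr (block_mx a 0 0 b) mm nn bv)
  (pos_block_diag n0 (posZ _ _ _ n0 k0 pa) (posZ _ _ _ n0 k0 pb)).
by rewrite compr_block add_block_mx !addr0 !comprZ -!scalemxVD !subrKC -starmx_compr.
Qed.

Lemma bnd_phase n k (z : C) (v : 'M[V]_n) : (0 < n)%N -> 0 <= k ->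
  z^*%R * z = 1 -> bnd k v -> bnd k (scalemxV z v).
Proof.
move=> n0 k0 z1 bv.
have -> : scalemxV z v = compr 1%:M v (z *: 1%:M) by rewrite comprZr compr1.
apply: bnd_compr => //; rewrite ?comprZr ?comprZl ?compr1 ?scalemxVA.
  by rewrite subrr; exact: pos0.
by rewrite mulrC z1 scalemxV1 subrr; exact: pos0.
Qed.

Lemma bnd_scale n k c (v : 'M[V]_n) : (0 < n)%N -> 0 <= k -> bnd k v ->
  bnd (`|c| * k) (scalemxV c%:C v).
Proof.
move=> n0 k0; wlog c0 : c v / 0 <= c => [h bv|bv].
  have [/h h'|c0] := leP 0 c; first exact: h'.
  have -> : scalemxV c%:C v = scalemxV (- c)%:C (scalemxV (-1) v).
    by rewrite scalemxVA mulrN1 rmorphN opprK.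
  rewrite -normrN; apply: h; first by rewrite oppr_ge0 ltW.
  by apply: bnd_phase => //; rewrite rmorphN rmorph1 mulrNN mulr1.
have := posZ _ _ _ (gt0_dbl n0) c0 bv.
rewrite /scalemxV map_block_mx -!/(scalemxV _ _) !scalemxVA -rmorphM.
by rewrite /bnd ger0_norm // starmx_scale conj_real.
Qed.

Lemma pos_sub_sel m n (f : 'I_m -> 'I_n) : injective f -> (0 < n)%N ->
  pos n (e n - compr (selmx R f) (e m) (selmx R f)).
Proof.
move=> fI n0; rewrite compr_scalar selmx_adjl //.
have -> : e n - map_mx ( *:%R^~ (ounit : V))
    (diag_mx (\row_j (j \in codom f)%:R%:C)) =
  map_mx ( *:%R^~ (ounit : V)) (diag_mx (\row_j (j \notin codom f)%:R%:C)).
  apply/matrixP => i j; rewrite !mxE.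
  case: eqP => [_|_]; last by rewrite !mulr0n scale0r subr0.
  rewrite !mulr1n; case: (i \in codom f) => /=.
    by rewrite scale1r scale0r subrr.
  by rewrite scale1r scale0r subr0.
by apply: pos_diag => // i; exact: ler0n.
Qed.

Lemma bnd_sel m n k (f g : 'I_m -> 'I_n) (v : 'M[V]_m) :
  injective f -> injective g -> (0 < m)%N -> (0 < n)%N -> 0 <= k ->
  bnd k v -> bnd k (compr (selmx R f) v (selmx R g)).
Proof. by move=> fI gI m0 n0 k0; apply: bnd_compr => //; exact: pos_sub_sel. Qed.

(** Compress $ke+b$ by the row $[1\ 1]$ and $ke-b$ by $[1\ {-1}]$: half the sum of the results is
    the required block matrix. *)
Lemma bnd_sa (b : V) : star b = b -> exists2 k, 0 <= k & bnd k (b%:M : 'M_1).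
Proof.
move=> sb; have [k [k0 p q]] := ounitP b sb; exists k; first exact: ltW.
have := posD (1 + 1) _ _ isT (pos_compr (row_mx 1%:M 1%:M : 'M_(1, 1 + 1)) isT isT p)
                      (pos_compr (row_mx 1%:M (- 1%:M) : 'M_(1, 1 + 1)) isT isT q).
have h : 0 <= (2 : R)^-1 by rewrite invr_ge0.
move=> /(posZ (1 + 1) _ _ isT h); rewrite !compr_row /bnd; congr pos.
rewrite !comprNr !comprNl !compr1 add_block_mx opprK.
rewrite /scalemxV map_block_mx -!/(scalemxV _ _).
have two (v : V) : (2^-1 : R)%:C *: (v + v) = v.
  rewrite -mulr2n -scaler_nat scalerA fmorphV /= rmorph_nat mulVf ?scale1r //.
  by rewrite pnatr_eq0.
by congr block_mx; apply/matrixP => i j; rewrite !ord1 !mxE /= ?mulr1n ?sb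
  ?opprD ?opprK addrACA ?subrr ?addr0 ?add0r two.
Qed.

Lemma bnd1_exists (a : V) : exists2 k, 0 <= k & bnd k (a%:M : 'M_1).
Proof.
have [k k0 bk] : exists2 k, 0 <= k & bnd k ((a + star a)%:M : 'M_1).
  by apply: bnd_sa; rewrite starD starK addrC.
have [l l0 bl] : exists2 k, 0 <= k & bnd k (('i%C *: (a - star a))%:M : 'M_1).
  apply: bnd_sa; rewrite starZ conj_i starD scaleNr -scalerN opprD.
  have -> : star (- star a) = - a.
    by apply: (@addrI _ a); rewrite -{1}[a]starK -starD !subrr star0.
  by rewrite opprK addrC.
exists (`|2^-1| * (k + l)); first by rewrite mulr_ge0 // addr_ge0.
(* Cartesian decomposition: [a + star a] and ['i%C *: (a - star a)] are self-adjoint, and the phase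
   $-i$ undoes the $i$ of the second. *)
have -> : a%:M = scalemxV (2^-1)%:C ((a + star a)%:M +
    scalemxV (- 'i%C : C) ('i%C *: (a - star a))%:M) :> 'M_1.
  apply/matrixP => i j; rewrite !ord1 !mxE /= !mulr1n scalerA.
  have -> : - ('i%C : C) * 'i%C = 1 by simpc.
  rewrite scale1r addrACA subrr addr0 -mulr2n -scaler_nat scalerA.
  by rewrite fmorphV /= rmorph_nat mulVf ?scale1r // pnatr_eq0.
apply: bnd_scale => //; first exact: addr_ge0.
apply: bndD => //; apply: bnd_phase => //.
by rewrite -{1}conj_i conjCK; simpc.
Qed.

Lemma bnd0 n k : (0 < n)%N -> 0 <= k -> bnd k (0 : 'M[V]_n).
Proof.
move=> n0 k0; rewrite /bnd starmx0.
by apply: pos_block_diag => //; apply: posZ => //; exact: pos_ounit.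
Qed.

(** A matrix is the sum of its entries, each placed by selections from a one-point index set, which
    are contractions. Adding 1, a bound for the zero matrix, makes the constant strictly
    positive. *)
Lemma bnd_exists n (v : 'M[V]_n) : (0 < n)%N -> exists2 k, 0 < k & bnd k v.
Proof.
move=> n0; have [k k0 bk] : exists2 k, 0 <= k & bnd k v; last first.
  exists (k + 1); first by rewrite ltr_wpDl.
  by rewrite -[v]addr0; apply: bndD => //; exact: bnd0.
have -> : v = \sum_i \sum_j compr (selmx R (fun _ : 'I_1 => i)) (v i j)%:M
                                (selmx R (fun _ : 'I_1 => j)).
  apply/matrixP => i j; rewrite summxE (bigD1 i) //= summxE (bigD1 j) //=.
  rewrite (compr_selE _ (f := fun _ => i) (g := fun _ => j) ord0 ord0);
    try by move=> *; rewrite !ord1.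
  rewrite mxE mulr1n.
  rewrite big1 ?addr0 => [|l lj]; last first.
    by rewrite compr_sel0 //; apply/orP; right; apply/codomP => -[_ /eqP];
      rewrite eq_sym (negPf lj).
  rewrite big1 ?addr0 // => k ki; rewrite summxE big1 // => l _.
  by rewrite compr_sel0 //; apply/orP; left; apply/codomP => -[_ /eqP];
      rewrite eq_sym (negPf ki).
have sumB (F : 'I_n -> 'M[V]_n) :
    (forall i, exists2 k, 0 <= k & bnd k (F i)) ->
    exists2 k, 0 <= k & bnd k (\sum_i F i).
  move=> bF; apply: (big_ind (fun w => exists2 k, 0 <= k & bnd k w)) =>
    [|u w [k k0 bk] [l l0 bl]|//].
    by exists 0 => //; exact: bnd0.
  by exists (k + l); [exact: addr_ge0|exact: bndD].
apply: (sumB) => i; apply: (sumB) => j; have [k k0 bk] := bnd1_exists (v i j).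
by exists k => //; apply: bnd_sel => // x y _; rewrite !ord1.
Qed.

Lemma normmx_le n k (v : 'M[V]_n) : 0 < k -> bnd k v -> normmx v <= k.
Proof.
by move=> k0 bv; apply: ge_inf => //; exists 0 => x [/ltW].
Qed.

Lemma normmx_lt n eps (v : 'M[V]_n) : (0 < n)%N -> normmx v < eps ->
  exists k, [/\ 0 < k, k < eps & bnd k v].
Proof.
move=> n0 lt; have [k k0 bk] := bnd_exists v n0.
(* On an empty set [inf] would return a default value, and a small norm would say nothing about
   [v]. *)
have hi : has_inf [set k : R | 0 < k /\ bnd k v].
  by split; [exists k|exists 0 => x [/ltW]].
rewrite -subr_gt0 in lt.
have [l [l0 bl]] := inf_adherent lt hi.
by rewrite addrC subrK => ll; exists l.
Qed.

End Bounds.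

(** * Homotopy of partial unitaries and maps that preserve it *)

Section Homotopy.
Variables (R : realType) (V : absMatrixOrderUnitType R).

(** The matrix of [f] is in general only a coisometry. Enumerating the [r] indices missed by [f]
    extends it to a bijection [g], whose matrix is unitary, and [push f u] is the [push g] of
    $u\oplus0_r$. The case [r = 0] is separate since direct summands must have positive size. *)
Lemma partial_unitary_push m k (f : 'I_m -> 'I_k) (u : 'M[V]_m) :
  injective f -> (0 < m)%N -> (0 < k)%N ->
  partial_unitary u -> partial_unitary (push f u).
Proof.
move=> fI m0 k0 pu.
pose r := #|[pred i | i \notin codom f]|.
have [r0|r0] := posnP r.
  have fS i : i \in codom f.
    by apply/negbNE/negP => h; have := card0_eq r0 i; rewrite inE h.
  apply: partial_unitary_unitary => //; last exact: selmx_adjr.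
  rewrite selmx_adjl //; apply/matrixP => i j; rewrite !mxE fS.
  by rewrite rmorph1; case: eqP.
pose g (i : 'I_(m + r)) : 'I_k :=
  match fintype.split i with inl a => f a | inr b => enum_val b end.
have gl i : g (lshift r i) = f i by rewrite /g (unsplitK (inl i)).
have gr i : g (rshift m i) = enum_val i by rewrite /g (unsplitK (inr i)).
have gI : injective g.
  have fe a (b : 'I_r) : f a <> enum_val b.
    by move=> h; have := enum_valP b; rewrite inE -h codom_f.
  move=> i j; case: (split_ordP i) => a ->; case: (split_ordP j) => b ->.
  - by rewrite !gl => /fI ->.
  - by rewrite gl gr => /fe.
  - by rewrite gl gr => /esym /fe.
  - by rewrite !gr => /enum_val_inj ->.
have gS i : i \in codom g.
  have [/codomP[a ->]|h] := boolP (i \in codom f).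
    by rewrite -gl codom_f.
  have ih : i \in [pred i | i \notin codom f] by [].
  by rewrite -(enum_rankK_in ih ih) -gr codom_f.
have -> : push f u = push g (dsum u (0 : 'M_r)).
  rewrite dsum0_push push_comp /push; congr compr; congr selmx;
  by apply/funext => i /=; rewrite gl.
apply: partial_unitary_unitary => //; first by rewrite addn_gt0 m0.
- rewrite selmx_adjl //; apply/matrixP => i j; rewrite !mxE gS.
  by rewrite rmorph1; case: eqP.
- exact: selmx_adjr.
by apply: partial_unitary_dsum => //; exact: partial_unitary0.
Qed.

Lemma homotopic_refl n (u : 'M[V]_n) : (0 < n)%N ->
  partial_unitary u -> homotopic u u.
Proof.
move=> n0 pu; exists (fun=> u); split=> // t _ eps eps0; exists 1 => // s _ _.
rewrite subrr; apply: le_lt_trans (_ : eps / 2 < _); last by lra.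
by apply: normmx_le; [lra|apply: bnd0 => //; lra].
Qed.

Lemma homotopic_sym n (u v : 'M[V]_n) : homotopic u v -> homotopic v u.
Proof.
move=> [f [fP fC f0 f1]]; exists (fun t => f (1 - t)); split.
- by move=> t t01; apply: fP; lra.
- move=> t t01 eps /(fC (1 - t) _)[|d d0 h]; first by lra.
  exists d => // s s01 st; apply: h; first by lra.
  by rewrite opprB addrC addrA subrK distrC.
- by rewrite subr0.
- by rewrite subrr.
Qed.

Lemma homotopic_trans n (u v w : 'M[V]_n) :
  homotopic u v -> homotopic v w -> homotopic u w.
Proof.
move=> [f [fP fC f0 f1]] [g [gP gC g0 g1]].
exists (fun t => if t <= 2^-1 then f (2 * t) else g (2 * t - 1)); split.
- by move=> t t01; case: leP => ht; [apply: fP|apply: gP]; lra.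
- have half (t s d : R) : `|s - t| < d / 2 -> `|2 * s - 2 * t| < d.
    by rewrite -mulrBr normrM ger0_norm // ; lra.
  move=> t t01 eps eps0; have [ht|ht|ht] := ltgtP t 2^-1.
  + have [|d d0 h] := fC (2 * t) _ eps eps0; first by lra.
    exists (Num.min (d / 2) (2^-1 - t)); first by rewrite lt_min; apply/andP; lra.
    move=> s s01; rewrite lt_min => /andP[/half sd]; rewrite ltr_norml => st.
    have -> : s <= 2^-1 by lra.
    by apply: h => //; lra.
  + have [|d d0 h] := gC (2 * t - 1) _ eps eps0; first by lra.
    exists (Num.min (d / 2) (t - 2^-1)); first by rewrite lt_min; apply/andP; lra.
    move=> s s01; rewrite lt_min => /andP[/half sd]; rewrite ltr_norml => st.
    have -> : (s <= 2^-1) = false by lra.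
    apply: h; first by lra.
    by have -> : 2 * s - 1 - (2 * t - 1) = 2 * s - 2 * t by lra.
  (* At the junction $t=1/2$ both pieces take the value [v], so the smaller of the two moduli serves
     on either side. *)
  + have [|d d0 h] := fC 1 _ eps eps0; first by lra.
    have [|c c0 k] := gC 0 _ eps eps0; first by lra.
    exists (Num.min (d / 2) (c / 2)); first by rewrite lt_min; apply/andP; lra.
    have t1 : 2 * t = 1 by lra.
    move=> s s01; rewrite lt_min => /andP[/half sd /half sc].
    rewrite t1 in sd sc *; case: (leP s) => hs; first by apply: h => //; lra.
    rewrite f1 -g0; apply: k; first by lra.
    by rewrite subr0.
- by rewrite mulr0 invr_ge0 ler0n f0.
- have -> : (1 <= 2^-1 :> R) = false by lra.
  by have -> : 2 * 1 - 1 = 1 :> R by lra.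
Qed.

(** It is enough that [F] keeps the admissible constants of differences: a norm below [eps] always
    supplies such a constant below [eps]. *)
Lemma homotopic_map m n (F : 'M[V]_m -> 'M[V]_n) (u v : 'M[V]_m) :
  (0 < m)%N ->
  (forall x, partial_unitary x -> partial_unitary (F x)) ->
  (forall k x y, 0 < k -> bnd k (x - y) -> bnd k (F x - F y)) ->
  homotopic u v -> homotopic (F u) (F v).
Proof.
move=> m0 FP FC [f [fP fC <- <-]]; exists (F \o f); split=> //.
  by move=> t t01; apply/FP/fP.
move=> t t01 eps eps0; have [d d0 h] := fC t t01 eps eps0.
exists d => // s s01 st; have [k [k0 ke bk]] := normmx_lt m0 (h s s01 st).
by apply: le_lt_trans ke; apply: normmx_le => //; exact: FC.
Qed.

Lemma homotopic_push m k (f : 'I_m -> 'I_k) (u v : 'M[V]_m) :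
  injective f -> (0 < m)%N -> (0 < k)%N ->
  homotopic u v -> homotopic (push f u) (push f v).
Proof.
move=> fI m0 k0; apply: homotopic_map => // [x|c x y c0].
  exact: partial_unitary_push.
by rewrite /push -comprB => h; apply: bnd_sel => //; exact: ltW.
Qed.

Lemma homotopic_dsum m n (u v : 'M[V]_m) (w : 'M[V]_n) :
  (0 < m)%N -> (0 < n)%N -> partial_unitary w ->
  homotopic u v -> homotopic (dsum u w) (dsum v w).
Proof.
move=> m0 n0 pw; have mn0 : (0 < m + n)%N by rewrite addn_gt0 m0.
apply: (homotopic_map (F := fun x => dsum x w)) => // [x px|c x y c0 h].
  exact: partial_unitary_dsum.
have -> : dsum x w - dsum y w = dsum (x - y) 0.
  by rewrite /dsum opp_block_mx add_block_mx !subrr.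
rewrite dsum0_push; apply: bnd_sel => //; [exact: lshift_inj..|exact: ltW].
Qed.

End Homotopy.

(** * Paths of unitaries attached to a self-adjoint involution *)

Section InvolutionPath.
Variables (R : realType) (V : absMatrixOrderUnitType R).
Local Notation C := R[i].

(** Together with [ratsin], the rational parametrization of the quarter circle from $(1,0)$ at $t=0$
    to $(0,1)$ at $t=1$; all estimates become polynomial inequalities. *)
Definition ratcos (t : R) := (1 - t ^+ 2) / (1 + t ^+ 2).
Definition ratsin (t : R) := 2 * t / (1 + t ^+ 2).

Lemma rational_circle (t : R) : 0 <= t <= 1 ->
  [/\ ratcos t ^+ 2 + ratsin t ^+ 2 = 1, `|ratcos t| <= 1 & `|ratsin t| <= 1].
Proof.
move=> t01; have t2 : 0 < 1 + t ^+ 2 by nra.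
have cs : ratcos t ^+ 2 + ratsin t ^+ 2 = 1.
  by rewrite /ratcos /ratsin; field; rewrite gt_eqF.
by split=> //; rewrite ler_norml; apply/andP; split; nra.
Qed.

Section InvolutionCircle.
Variables (n : nat) (P : 'M[C]_n) (u : 'M[V]_n).
Hypotheses (n0 : (0 < n)%N) (PP : adjmx P = P) (PI : P *m P = 1%:M).
Variables (c s : R).
Hypothesis cs : c ^+ 2 + s ^+ 2 = 1.

(* The unitaries [c + i s P] with [c^2 + s^2 = 1] join [1] to [i P], and
   conjugation by [i P] is conjugation by [P]; no sign has to be corrected,
   unlike with plane rotations. *)
Definition involution_path : 'M[C]_n := c%:C *: 1%:M + ('i%C * s%:C) *: P.
Local Notation U := involution_path.

Lemma conj_is : ('i%C * s%:C)^*%R = - ('i%C * s%:C) :> C.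
Proof.
by rewrite rmorphM -mulNr; congr (_ * _); [exact: conj_i|exact: conj_real].
Qed.

Let ss : ('i%C * s%:C) * ('i%C * s%:C) = - (s ^+ 2)%:C :> C.
Proof. by rewrite mulrACA -expr2 sqr_i mulN1r -rmorphM. Qed.

Let adjU : adjmx U = c%:C *: 1%:M - ('i%C * s%:C) *: P.
Proof. by rewrite adjmxD !adjmxZ adjmx1 PP conj_is conj_real scaleNr. Qed.

Let csC : (c ^+ 2)%:C + (s ^+ 2)%:C = 1 :> C.
Proof. by rewrite -rmorphD cs. Qed.

Lemma involution_path_unitaryl : adjmx U *m U = 1%:M.
Proof.
rewrite adjU mulmxDl !mulmxDr !mulNmx -!scalemxAl -!scalemxAr !mul1mx mulmx1.
rewrite PI !scalerA ss [(_ * _) * c%:C]mulrC scaleNr opprK.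
by rewrite addrA addrK -rmorphM -scalerDl csC scale1r.
Qed.

Lemma involution_path_unitaryr : U *m adjmx U = 1%:M.
Proof.
rewrite adjU mulmxDl !mulmxDr !mulmxN -!scalemxAl -!scalemxAr !mul1mx mulmx1.
rewrite PI !scalerA ss [(_ * _) * c%:C]mulrC scaleNr opprK.
by rewrite addrA subrK -rmorphM -scalerDl csC scale1r.
Qed.

(** Only three fixed matrices occur, $u$, $PuP$ and $i(uP-Pu)$, with real coefficients; continuity
    of the path reduces to that of $c^2$, $s^2$ and $cs$. *)
Lemma compr_involution_path : compr U u U =
  scalemxV (c ^+ 2)%:C u + scalemxV (s ^+ 2)%:C (compr P u P) +
  scalemxV (c * s)%:C (scalemxV 'i%C (compr 1%:M u P - compr P u 1%:M)).
Proof.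
rewrite /U comprDl !comprDr !comprZl !comprZr compr1 !scalemxVA.
rewrite conj_is conj_real !mulNr ss opprK.
move: (compr P u P) (compr 1%:M u P) (compr P u 1%:M) => x y z.
have -> : c%:C * ('i%C * s%:C) = (c * s)%:C * 'i%C :> C.
  by rewrite mulrCA -rmorphM mulrC.
have -> : 'i%C * s%:C * c%:C = (c * s)%:C * 'i%C :> C.
  by rewrite -mulrA mulrC -rmorphM [s * c]mulrC.
rewrite -rmorphM; apply/matrixP => i j; rewrite !mxE scalerBr scaleNr -!addrA.
by congr (_ + _); rewrite [RHS]addrC -addrA [- _ + _]addrC.
Qed.

End InvolutionCircle.

(** Over the common denominator, which is at least 1, the differences are $s-t$ times $-2(s+t)$ and
    $2(1-st)$, both of modulus at most 4. *)
Lemma rational_circle_lipschitz (s t : R) : 0 <= s <= 1 -> 0 <= t <= 1 ->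
  `|ratcos s - ratcos t| <= 4 * `|s - t| /\ `|ratsin s - ratsin t| <= 4 * `|s - t|.
Proof.
move=> s01 t01; have s2 : 1 <= 1 + s ^+ 2 by nra.
have t2 : 1 <= 1 + t ^+ 2 by nra.
have d1 : 1 <= (1 + s ^+ 2) * (1 + t ^+ 2) by nra.
have d0 : 0 < (1 + s ^+ 2) * (1 + t ^+ 2) by lra.
have H a : `|a| <= 4 -> `|(s - t) * (a / ((1 + s ^+ 2) * (1 + t ^+ 2)))|
    <= 4 * `|s - t|.
  move=> a4; rewrite normrM mulrC ler_wpM2r // normrM normfV (gtr0_norm d0).
  by rewrite ler_pdivrMr //; nra.
split.
  have -> : ratcos s - ratcos t =
      (s - t) * ((-2 * (s + t)) / ((1 + s ^+ 2) * (1 + t ^+ 2))).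
    by rewrite /ratcos; field; rewrite !gt_eqF //; lra.
  by apply: H; rewrite ler_norml; apply/andP; split; nra.
have -> : ratsin s - ratsin t =
    (s - t) * ((2 * (1 - s * t)) / ((1 + s ^+ 2) * (1 + t ^+ 2))).
  by rewrite /ratsin; field; rewrite !gt_eqF //; lra.
by apply: H; rewrite ler_norml; apply/andP; split; nra.
Qed.

Lemma mul_lipschitz (a b a' b' d : R) : `|a| <= 1 -> `|b'| <= 1 ->
  `|a - a'| <= d -> `|b - b'| <= d -> `|a * b - a' * b'| <= 2 * d.
Proof.
move=> a1 b1 ad bd.
have -> : a * b - a' * b' = a * (b - b') + (a - a') * b' by ring.
apply: le_trans (ler_normD _ _) _; rewrite !normrM.
have := ler_pM (normr_ge0 _) (normr_ge0 _) a1 bd.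
have := ler_pM (normr_ge0 _) (normr_ge0 _) ad b1; lra.
Qed.

Lemma homotopic_involution n (P : 'M[C]_n) (u : 'M[V]_n) : (0 < n)%N ->
  adjmx P = P -> P *m P = 1%:M -> partial_unitary u ->
  homotopic u (compr P u P).
Proof.
move=> n0 PP PI pu.
pose U t := involution_path P (ratcos t) (ratsin t).
exists (fun t => compr (U t) u (U t)); split.
- move=> t t01; have [cs _ _] := rational_circle t01.
  apply: partial_unitary_unitary => //.
    exact: involution_path_unitaryl.
  exact: involution_path_unitaryr.
- move=> t t01 eps eps0.
  set y := compr P u P; set z := scalemxV ('i%C : C) (compr 1%:M u P - compr P u 1%:M).
  have [k k0 ku] := bnd_exists u n0.
  have [l l0 ly] := bnd_exists y n0.
  have [m m0 mz] := bnd_exists z n0.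
  (* Each coefficient changes by at most $8|s-t|$, so 16 keeps the total below [eps / 2]. The other
     half is added to the bound below, which must be positive even when $s=t$. *)
  have K0 : 0 < 16 * (k + l + m) by lra.
  exists (eps / (16 * (k + l + m))); first exact: divr_gt0.
  move=> s s01; rewrite ltr_pdivlMr // => st.
  have [_ c1 c2] := rational_circle s01; have [_ d1 d2] := rational_circle t01.
  have [L1 L2] := rational_circle_lipschitz s01 t01.
  set a := ratcos s ^+ 2 - ratcos t ^+ 2; set b := ratsin s ^+ 2 - ratsin t ^+ 2.
  set c := ratcos s * ratsin s - ratcos t * ratsin t.
  have A : `|a| <= 2 * (4 * `|s - t|) by exact: mul_lipschitz.
  have B : `|b| <= 2 * (4 * `|s - t|) by exact: mul_lipschitz.
  have D : `|c| <= 2 * (4 * `|s - t|) by exact: mul_lipschitz.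
  apply: le_lt_trans (normmx_le (k := `|a| * k + `|b| * l + `|c| * m + eps / 2) _ _) _.
  + by rewrite ltr_wpDl ?divr_gt0 // !addr_ge0 // mulr_ge0 // ltW.
  + have -> : compr (U s) u (U s) - compr (U t) u (U t) =
        scalemxV a%:C u + scalemxV b%:C y + scalemxV c%:C z + 0.
      rewrite !compr_involution_path // -/y -/z addr0; clearbody y z.
      apply/matrixP => i j; rewrite !mxE /a /b /c !rmorphB !scalerBl.
      by rewrite opprD addrACA opprD [X in X + _ = _]addrACA.
    apply: bndD => //; last by apply: bnd0 => //; lra.
    apply: bndD => //; last by apply: bnd_scale => //; exact: ltW.
    by apply: bndD => //; apply: bnd_scale => //; exact: ltW.
  + have := ler_wpM2r (ltW k0) A; have := ler_wpM2r (ltW l0) B.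
    by have := ler_wpM2r (ltW m0) D; lra.
- rewrite /U /involution_path /ratcos /ratsin expr0n /= mulr0 mul0r subr0 addr0 divr1.
  by rewrite mulr0 scale0r addr0 scale1r compr1.
- rewrite /U /involution_path /ratcos /ratsin expr1n subrr mul0r scale0r add0r mulr1.
  have -> : 2 / (1 + 1) = 1 :> R by rewrite -mulr2n divff ?pnatr_eq0.
  rewrite mulr1 comprZl comprZr scalemxVA conj_i mulNr.
  by rewrite -expr2 sqr_i opprK scalemxV1.
Qed.

End InvolutionPath.

(** * Independence of position and the semigroup laws up to [simK] *)

Section StableHomotopy.
Variables (R : realType) (V : absMatrixOrderUnitType R).

Section Swap.
Variables (m k : nat) (f g : 'I_m -> 'I_k).
Hypotheses (fI : injective f) (gI : injective g).
Hypothesis fg : forall i j, f i != g j.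

(** Exchanges [f i] with [g i] and fixes the remaining indices. Disjoint images make it an
    involution, so that its 0-1 matrix is self-adjoint with square 1. *)
Definition swap (y : 'I_k) : 'I_k :=
  if [pick i | f i == y] is Some i then g i
  else if [pick i | g i == y] is Some i then f i else y.

Lemma swap_f i : swap (f i) = g i.
Proof.
rewrite /swap; case: pickP => [j /eqP/fI ->//|/(_ i)].
by rewrite eqxx.
Qed.

Lemma swap_g i : swap (g i) = f i.
Proof.
rewrite /swap; case: pickP => [j|_]; first by rewrite (negPf (fg _ _)).
case: pickP => [j /eqP/gI ->//|/(_ i)].
by rewrite eqxx.
Qed.

Lemma swapK : involutive swap.
Proof.
move=> y; rewrite {2}/swap; case: pickP => [i /eqP <-|nf].
  by rewrite swap_g.
case: pickP => [i /eqP <-|ng]; first by rewrite swap_f.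
rewrite /swap; case: pickP => [i|_]; first by rewrite nf.
by case: pickP => [i|//]; rewrite ng.
Qed.

Lemma homotopic_push_disjoint (u : 'M[V]_m) : (0 < m)%N -> (0 < k)%N ->
  partial_unitary u -> homotopic (push f u) (push g u).
Proof.
move=> m0 k0 pu.
have -> : g = swap \o f by apply/funext => i /=; rewrite swap_f.
rewrite -push_comp; apply: homotopic_involution => //.
- apply/matrixP => i j; rewrite !mxE conjC_nat.
  by rewrite (can2_eq swapK swapK) eq_sym.
- rewrite selmx_comp; apply/matrixP => i j.
  by rewrite !mxE /= swapK.
- exact: partial_unitary_push.
Qed.

End Swap.

Lemma pad_push m k (lt : (m < k)%N) (u : 'M[V]_m) :
  pad lt u = push (widen_ord (ltnW lt)) u.
Proof.
apply: pushP => [i j /(congr1 val) /= /val_inj//|i j|i j].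
  rewrite castmxE dsum0_push -[RHS](pushE _ _ _ (lshift_inj (n := k - m))).
  by congr (push _ _ _ _); apply: val_inj.
rewrite castmxE dsum0_push => h; apply: push0E.
have H (l : 'I_k) : l \notin codom (widen_ord (ltnW lt)) ->
    cast_ord (esym (subnKC (ltnW lt))) l \notin codom (@lshift m (k - m)).
  apply: contra => /codomP[a la]; apply/codomP; exists a; apply: val_inj => /=.
  by move/(congr1 val): la.
by case/orP: h => /H ->; rewrite ?orbT.
Qed.

(** Frees [simK] from the upper left corner of a strictly larger matrix. A given placement may
    overlap that corner, so a single swap need not join them and spare coordinates are required. *)
Lemma simK_push (u v : PU V) k (f : 'I_(pu_size u) -> 'I_k)
    (g : 'I_(pu_size v) -> 'I_k) : injective f -> injective g -> (0 < k)%N ->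
  homotopic (push f (pu_mx u)) (push g (pu_mx v)) -> simK u v.
Proof.
move=> fI gI k0 h.
have m0 := pu_size_gt0 u; have n0 := pu_size_gt0 v.
have mk : (pu_size u <= k)%N by have := leq_card f fI; rewrite !card_ord.
have nk : (pu_size v <= k)%N by have := leq_card g gI; rewrite !card_ord.
(* The added coordinates have room for a copy of either matrix and make [K] strictly larger than
   both sizes. *)
pose K := (k + (pu_size u + pu_size v))%N.
have K0 : (0 < K)%N by rewrite addn_gt0 k0.
have ltu : (pu_size u < K)%N.
  by rewrite (leq_ltn_trans mk) // -[X in (X < _)%N]addn0 ltn_add2l addn_gt0 m0.
have ltv : (pu_size v < K)%N.
  by rewrite (leq_ltn_trans nk) // -[X in (X < _)%N]addn0 ltn_add2l addn_gt0 m0.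
exists K, ltu, ltv; rewrite !pad_push.
have wI p (lt : (p <= K)%N) : injective (widen_ord lt).
  by move=> i j /(congr1 val) /= /val_inj.
(* Both [push]es use only the first [k] coordinates, so each can be moved to
   the last coordinates and back. *)
have to_end (w : PU V) (a b : 'I_(pu_size w) -> 'I_K)
    (c : 'I_(pu_size w) -> 'I_(pu_size u + pu_size v)) :
    injective a -> injective b -> injective c ->
    (forall i, (a i < k)%N) -> (forall i, (b i < k)%N) ->
    homotopic (push a (pu_mx w)) (push b (pu_mx w)).
  move=> aI bI cI ak bk; have w0 := pu_size_gt0 w; have pw := pu_mxP w.
  have rI : injective (@rshift k _ \o c) by apply: inj_comp; [exact: rshift_inj|].
  have D (l : 'I_K) i : (l < k)%N -> l != rshift k (c i).
    by apply: contraTneq => -> /=; rewrite -leqNgt leq_addr.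
  apply: (@homotopic_trans _ _ _ _ (push (@rshift k _ \o c) (pu_mx w))).
    by apply: homotopic_push_disjoint => // i j; exact: D.
  apply: homotopic_sym.
  by apply: homotopic_push_disjoint => // i j; exact: D.
have lI p : injective (@lshift k p) by exact: lshift_inj.
apply: (@homotopic_trans _ _ _ _ (push (lshift (pu_size u + pu_size v) \o f) (pu_mx u))).
  apply: (to_end _ _ _ (lshift _)) => [| | |i|i].
  - exact: wI.
  - by apply: inj_comp; first exact: lI.
  - exact: lshift_inj.
  - exact: leq_trans (ltn_ord i) mk.
  - exact: (ltn_ord (f i)).
apply: (@homotopic_trans _ _ _ _ (push (lshift (pu_size u + pu_size v) \o g) (pu_mx v))).
  by rewrite -(push_comp f) -(push_comp g); apply: homotopic_push.
apply: (to_end _ _ _ (@rshift _ _)) => [| | |i|i].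
- by apply: inj_comp; first exact: lI.
- exact: wI.
- exact: rshift_inj.
- exact: (ltn_ord (g i)).
- exact: leq_trans (ltn_ord i) nk.
Qed.

Lemma simKP (u v : PU V) : simK u v <->
  exists k (f : 'I_(pu_size u) -> 'I_k) (g : 'I_(pu_size v) -> 'I_k),
    [/\ injective f, injective g, (0 < k)%N &
        homotopic (push f (pu_mx u)) (push g (pu_mx v))].
Proof.
split=> [[k [ltu [ltv]]]|[k [f [g [fI gI k0 h]]]]]; last exact: simK_push h.
rewrite !pad_push => h.
exists k, (widen_ord (ltnW ltu)), (widen_ord (ltnW ltv)); split=> //.
- by move=> i j /(congr1 val) /= /val_inj.
- by move=> i j /(congr1 val) /= /val_inj.
- exact: (leq_ltn_trans (leq0n _) ltu).
Qed.

Lemma simK_refl (u : PU V) : simK u u.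
Proof.
apply/simKP; exists (pu_size u), id, id; have u0 := pu_size_gt0 u.
split=> //; rewrite push_id; apply: homotopic_refl => //; exact: pu_mxP.
Qed.

Lemma simK_sym (u v : PU V) : simK u v -> simK v u.
Proof.
move=> /simKP [k [f [g [fI gI k0 /homotopic_sym h]]]].
by apply/simKP; exists k, g, f.
Qed.

(** The two homotopies live in sizes [k] and [l]. Run in the first [k] and the last [l] coordinates
    of size [k + l], they meet in two disjoint placements of [v], which a swap joins. *)
Lemma simK_trans (u v w : PU V) : simK u v -> simK v w -> simK u w.
Proof.
move=> /simKP [k [f [g [fI gI k0 h]]]] /simKP [l [f' [g' [fI' gI' l0 h']]]].
have lI : injective (@lshift k l) by exact: lshift_inj.
have rI : injective (@rshift k l) by exact: rshift_inj.
have kl0 : (0 < k + l)%N by rewrite addn_gt0 k0.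
apply/simKP; exists (k + l)%N, (lshift l \o f), (@rshift k l \o g').
split=> //; try exact: inj_comp.
apply: (@homotopic_trans _ _ _ _ (push (lshift l \o g) (pu_mx v))).
  by rewrite -(push_comp f) -(push_comp g); apply: homotopic_push.
apply: (@homotopic_trans _ _ _ _ (push (@rshift k l \o f') (pu_mx v))); last first.
  by rewrite -(push_comp f') -(push_comp g'); apply: homotopic_push.
apply: homotopic_push_disjoint => //; try exact: inj_comp.
- by move=> i j /=; rewrite eq_lrshift.
- exact: pu_size_gt0.
- exact: pu_mxP.
Qed.

(** Here [v] is itself [push f u], so a constant path suffices; commutativity and associativity
    become reindexings. *)
Lemma simK_bij (u v : PU V) (f : 'I_(pu_size u) -> 'I_(pu_size v)) :
  bijective f -> (forall i j, pu_mx v (f i) (f j) = pu_mx u i j) -> simK u v.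
Proof.
move=> fB fE; have fI := bij_inj fB; have v0 := pu_size_gt0 v.
apply/simKP; exists (pu_size v), f, id; split=> //.
rewrite push_id -(@pushP _ _ _ _ f (pu_mx u) (pu_mx v)) //.
  by apply: homotopic_refl => //; exact: pu_mxP.
case: fB => g _ gK i j.
by rewrite -(gK i) -(gK j) !codom_f.
Qed.

Lemma simK_sumC (u v : PU V) : simK (pu_sum u v) (pu_sum v u).
Proof.
pose s m n (i : 'I_(m + n)) : 'I_(n + m) :=
  match fintype.split i with inl a => rshift n a | inr b => lshift m b end.
have sl m n (i : 'I_m) : s m n (lshift n i) = rshift n i.
  by rewrite /s (unsplitK (inl i)).
have sr m n (i : 'I_n) : s m n (rshift m i) = lshift m i.
  by rewrite /s (unsplitK (inr i)).
have sK m n : cancel (s m n) (s n m).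
  by move=> i; case: (split_ordP i) => a ->; rewrite ?sl ?sr ?sl.
apply: (@simK_bij (pu_sum u v) (pu_sum v u) (s _ _)).
  by exists (s _ _); exact: sK.
move=> i j; rewrite /= /dsum.
by case: (split_ordP i) => a ->; case: (split_ordP j) => b ->;
  rewrite ?sl ?sr ?(block_mxEul, block_mxEur, block_mxEdl, block_mxEdr) ?mxE.
Qed.

Lemma dsumA m n p (a : 'M[V]_m) (b : 'M[V]_n) (c : 'M[V]_p) i j :
  dsum (dsum a b) c (cast_ord (addnA m n p) i) (cast_ord (addnA m n p) j) =
  dsum a (dsum b c) i j.
Proof.
have El (x : 'I_m) : cast_ord (addnA m n p) (lshift (n + p) x) =
  lshift p (lshift n x) by apply: val_inj.
have Em (x : 'I_n) : cast_ord (addnA m n p) (rshift m (lshift p x)) =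
  lshift p (rshift m x) by apply: val_inj.
have Er (x : 'I_p) : cast_ord (addnA m n p) (rshift m (rshift n x)) =
  rshift (m + n) x by apply: val_inj; rewrite /= addnA.
rewrite /dsum.
case: (split_ordP i) => i' ->; last case: (split_ordP i') => i'' ->;
(case: (split_ordP j) => j' ->; last case: (split_ordP j') => j'' ->);
by rewrite ?El ?Em ?Er
  ?(block_mxEul, block_mxEur, block_mxEdl, block_mxEdr, mxE)
  ?(block_mxEul, block_mxEur, block_mxEdl, block_mxEdr, mxE).
Qed.

Lemma simK_sumA (u v w : PU V) :
  simK (pu_sum u (pu_sum v w)) (pu_sum (pu_sum u v) w).
Proof.
apply: (@simK_bij (pu_sum u (pu_sum v w)) (pu_sum (pu_sum u v) w)
  (cast_ord (addnA _ _ _))); last exact: dsumA.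
exists (cast_ord (esym (addnA _ _ _))); [exact: cast_ordK|exact: cast_ordKV].
Qed.

Lemma simK_suml (u v w : PU V) : simK u v -> simK (pu_sum u w) (pu_sum v w).
Proof.
move=> /simKP [k [f [g [fI gI k0 h]]]].
have w0 := pu_size_gt0 w; pose r := pu_size w.
(* Extending [a] by the identity on the coordinates of [w] makes placement commute with adding the
   summand [w]. *)
pose s m (a : 'I_m -> 'I_k) (i : 'I_(m + r)) : 'I_(k + r) :=
  match fintype.split i with inl x => lshift r (a x) | inr y => rshift k y end.
have sl m (a : 'I_m -> 'I_k) x : s m a (lshift r x) = lshift r (a x).
  by rewrite /s (unsplitK (inl x)).
have sr m (a : 'I_m -> 'I_k) x : s m a (rshift m x) = rshift k x.
  by rewrite /s (unsplitK (inr x)).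
have sI m (a : 'I_m -> 'I_k) : injective a -> injective (s m a).
  move=> aI i j; case: (split_ordP i) => x ->; case: (split_ordP j) => y ->;
  rewrite ?sl ?sr => /eqP; rewrite ?eq_lrshift ?eq_rlshift //.
    by rewrite eq_lshift => /eqP/aI ->.
  by rewrite eq_rshift => /eqP ->.
have sE m (a : 'I_m -> 'I_k) (x : 'M[V]_m) : injective a ->
    push (s m a) (dsum x (pu_mx w)) = dsum (push a x) (pu_mx w).
  move=> aI; apply/esym/pushP; first exact: sI.
    move=> i j; case: (split_ordP i) => p ->; case: (split_ordP j) => q ->;
    rewrite ?sl ?sr /dsum
      ?(block_mxEul, block_mxEur, block_mxEdl, block_mxEdr) ?pushE // !mxE //.
  have codl (l : 'I_k) : lshift r l \notin codom (s m a) -> l \notin codom a.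
    by apply: contra => /codomP[p ->]; rewrite -sl codom_f.
  have codr (l : 'I_r) : rshift k l \notin codom (s m a) -> false.
    by rewrite -(sr m a) codom_f.
  move=> i j; case: (split_ordP i) => p ->; case: (split_ordP j) => q ->;
  rewrite /dsum ?(block_mxEul, block_mxEur, block_mxEdl, block_mxEdr);
  try by move=> _; rewrite mxE.
    by move=> /orP[] /codl h'; rewrite push0E ?h' ?orbT.
  by move=> /orP[] /codr.
apply/simKP; exists (k + r)%N, (s _ f), (s _ g); split.
- exact: sI.
- exact: sI.
- by rewrite addn_gt0 k0.
- by rewrite /= !sE //; apply: homotopic_dsum => //; exact: pu_mxP.
Qed.

End StableHomotopy.

(** * The Grothendieck group of the semigroup of [simK] classes *)

Section GrothendieckGroup.
Variables (R : realType) (V : absMatrixOrderUnitType R).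
Implicit Types u v w : PU V.

Definition simKclass u : set (PU V) := [set v | simK u v].

Lemma simKclassP u v : simKclass u = simKclass v <-> simK u v.
Proof.
split=> [h|h].
  have : simKclass v v by exact: simK_refl.
  by rewrite -h.
apply/seteqP; split=> w /=; first exact/simK_trans/simK_sym.
exact: simK_trans.
Qed.

(* Associative and commutative on arbitrary sets, so that sums of classes can
   be rearranged by rewriting without a quotient type. *)
Definition sumK (A B : set (PU V)) : set (PU V) :=
  [set w | exists u v, [/\ A u, B v & simK (pu_sum u v) w]].

Lemma simK_sumr u v w : simK v w -> simK (pu_sum u v) (pu_sum u w).
Proof.
move=> /(simK_suml u) h; apply: simK_trans (simK_sumC _ _) _.
by apply: simK_trans h (simK_sumC _ _).
Qed.

Lemma sumK_class u v : sumK (simKclass u) (simKclass v) = simKclass (pu_sum u v).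
Proof.
apply/seteqP; split=> [w [u' [v' [/= uu vv]]]|w h].
  apply: simK_trans; apply: simK_trans (simK_suml _ uu) _; exact: simK_sumr.
by exists u, v; split=> //=; exact: simK_refl.
Qed.

Lemma sumKC : commutative sumK.
Proof.
by move=> A B; apply/seteqP; split=> w [u [v [Au Bv h]]]; exists v, u; split=> //;
  apply: simK_trans (simK_sumC _ _) h.
Qed.

Lemma sumKA : associative sumK.
Proof.
move=> A B D; apply/seteqP; split=> w.
  move=> [u [x [Au [v [t [Bv Dt vt]]] h]]].
  exists (pu_sum u v), t; split=> //.
    by exists u, v; split=> //; exact: simK_refl.
  apply: simK_trans (simK_sym (simK_sumA _ _ _)) _.
  exact: simK_trans (simK_sumr _ vt) h.
move=> [x [t [[u [v [Au Bv uv]]] Dt h]]].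
exists u, (pu_sum v t); split=> //.
  by exists v, t; split=> //; exact: simK_refl.
apply: simK_trans (simK_sumA _ _ _) _.
exact: simK_trans (simK_suml _ uv) h.
Qed.

Local Notation "A ⊕ B" := (sumK A B) (at level 50, left associativity).
Local Notation c := simKclass.

Lemma sumKACA (A B D E : set (PU V)) : (A ⊕ B) ⊕ (D ⊕ E) = (A ⊕ D) ⊕ (B ⊕ E).
Proof. by rewrite -!sumKA [B ⊕ (D ⊕ E)]sumKA [B ⊕ D]sumKC !sumKA. Qed.

(** The usual Grothendieck relation with a stabilizing term, now an equality of sets open to
    rewriting. *)
Lemma equivKP u v u' v' : equivK (u, v) (u', v') <->
  exists w, c u ⊕ c v' ⊕ c w = c u' ⊕ c v ⊕ c w.
Proof.
by split=> -[w h]; exists w; move: h; rewrite !sumK_class => /simKclassP.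
Qed.

Lemma equivK_simK u v u' v' : simK u u' -> simK v v' ->
  equivK (u, v) (u', v').
Proof.
move=> /simKclassP hu /simKclassP hv; apply/equivKP; exists u.
by rewrite hu hv.
Qed.

Lemma equivK_refl : Reflexive (@equivK R V).
Proof. by move=> [u v]; apply: equivK_simK; exact: simK_refl. Qed.

Lemma equivK_sym : Symmetric (@equivK R V).
Proof. by move=> [u v] [u' v'] /equivKP [w h]; apply/equivKP; exists w. Qed.

Lemma equivK_trans : Transitive (@equivK R V).
Proof.
move=> [u v] [u' v'] [u'' v''] /equivKP [w h] /equivKP [w' h'].
(* Adding the two equations leaves the middle pair on both sides. It cannot be cancelled, so it
   joins the stabilizing term. *)
apply/equivKP; exists (pu_sum (pu_sum u' v') (pu_sum w w')).
rewrite -!sumK_class.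
have E A B D F G H : A ⊕ B ⊕ (D ⊕ F ⊕ (G ⊕ H)) = (A ⊕ F ⊕ G) ⊕ (D ⊕ B ⊕ H).
  by rewrite [RHS]sumKACA [D ⊕ B]sumKC (sumKACA A F) [F ⊕ D]sumKC sumKA.
by rewrite E h h' [c w ⊕ c w']sumKC E sumKC.
Qed.

Lemma equivK_equivalence : Equivalence (@equivK R V).
Proof. by split; [exact: equivK_refl|exact: equivK_sym|exact: equivK_trans]. Qed.

Lemma equivK_sum u v u' v' x y x' y' :
  equivK (u, v) (u', v') -> equivK (x, y) (x', y') ->
  equivK (pu_sum u x, pu_sum v y) (pu_sum u' x', pu_sum v' y').
Proof.
move=> /equivKP [w h] /equivKP [w' h']; apply/equivKP; exists (pu_sum w w').
rewrite -!sumK_class.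
have E A B D F G H : A ⊕ B ⊕ (D ⊕ F) ⊕ (G ⊕ H) = (A ⊕ D ⊕ G) ⊕ (B ⊕ F ⊕ H).
  by rewrite (sumKACA A) sumKACA.
by rewrite !E h h'.
Qed.

Lemma K_eq (a b : K V) : sval a = sval b -> a = b.
Proof.
case: a b => [a pa] [b pb] /= ab; case: _ / ab pb => pb.
by congr exist; exact: Prop_irrelevance.
Qed.

Lemma KclassP u v u' v' :
  Kclass u v = Kclass u' v' <-> equivK (u, v) (u', v').
Proof.
split=> [/(congr1 sval) /= h|h].
  have : eclass (u', v') (u', v') by exact: equivK_refl.
  by rewrite -h.
apply: K_eq; apply/seteqP; split=> q /=; last exact: equivK_trans.
exact/equivK_trans/equivK_sym.
Qed.

Lemma Kclass_surj (a : K V) : exists p : PU V * PU V, a = Kclass p.1 p.2.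
Proof.
by case: (svalP a) => -[u v] _ E; exists (u, v); apply: K_eq.
Qed.

Definition Krepr (a : K V) : PU V * PU V := sval (cid (Kclass_surj a)).

Lemma KreprK (a : K V) : a = Kclass (Krepr a).1 (Krepr a).2.
Proof. exact: svalP (cid (Kclass_surj a)). Qed.

(** Formed from chosen representatives; [addK_class] shows that the choice does not matter. *)
Definition addK (a b : K V) : K V :=
  Kclass (pu_sum (Krepr a).1 (Krepr b).1) (pu_sum (Krepr a).2 (Krepr b).2).

Lemma addK_class u v u' v' :
  addK (Kclass u v) (Kclass u' v') = Kclass (pu_sum u u') (pu_sum v v').
Proof.
by apply/KclassP/equivK_sum; apply/KclassP; rewrite -KreprK.
Qed.

Lemma addK_abelian_group : abelian_group addK.
Proof.
split.
- move=> a b d; rewrite (KreprK a) (KreprK b) (KreprK d) !addK_class.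
  by apply/KclassP/equivK_simK; exact: simK_sumA.
- move=> a b; rewrite (KreprK a) (KreprK b) !addK_class.
  by apply/KclassP/equivK_simK; exact: simK_sumC.
(* Sizes are positive, so the $1\times1$ zero matrix stands in for an empty summand; the pair of two
   equal entries is neutral. *)
pose z : PU V := MkPU (ltn0Sn 0) (partial_unitary0 V (ltn0Sn 0)).
exists (Kclass z z); split=> [a|a].
  rewrite [in RHS](KreprK a) [in LHS](KreprK a) addK_class.
  apply/KclassP/equivKP; exists z; rewrite -!sumK_class.
  by rewrite [c z ⊕ _]sumKC -(sumKA _ (c z)).
(* The negative exchanges the components: the sum then has equal components up to the order of
   summands. *)
exists (Kclass (Krepr a).2 (Krepr a).1); rewrite {3}(KreprK a) addK_class.
apply/KclassP/equivKP; exists z; rewrite -!sumK_class.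
by congr sumK; rewrite sumKC [X in sumK _ X]sumKC.
Qed.

End GrothendieckGroup.

Theorem theorem4p14 (R : realType) (V : absMatrixOrderUnitType R) :
  Equivalence (@equivK R V) /\
  exists add : K V -> K V -> K V,
    (forall u1 v1 u2 v2 : PU V,
       add (Kclass u1 v1) (Kclass u2 v2) =
       Kclass (pu_sum u1 u2) (pu_sum v1 v2)) /\
    abelian_group add.
Proof.
split; first exact: equivK_equivalence.
exists (@addK R V); split; [exact: addK_class|exact: addK_abelian_group].
Qed.
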